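(* Let $\bar{\mathbf B}$ be a smooth state on the space-time domain $\Omega$, given by $(\rho,s,s_1,s_2,a_{\mathrm i},y,\alpha,\mathbf u)$ together with $\mathrm D_t\alpha$ and $\mathrm D_ta_{\mathrm i}$, satisfying $\partial_t\rho+\operatorname{div}(\rho\mathbf u)=0$, $\mathrm D_ty=0$, $\mathrm D_ts=\mathrm D_ts_1=\mathrm D_ts_2=0$. Suppose that $\bar{\mathbf B}$ is a stationary point of the action $A(\mathbf B)=\int_\Omega L(\mathbf B)\,\mathrm d\mathbf x\,\mathrm dt$ with respect to admissible variations, i.e. $$\int_\Omega\sum_{b\in\mathbf B}\frac{\partial L}{\partial b}\,\delta b\;\mathrm d\mathbf x\,\mathrm dt=0$$ for all admissible variations generated by independent $\delta\mathbf x,\delta\alpha,\delta a_{\mathrm i}$ as described in the context. Then, with $M=\dfrac{\partial L}{\partial(\mathrm D_t\alpha)}$, $P=\dfrac{\partial L}{\partial(\mathrm D_ta_{\mathrm i})}$, $K=\dfrac{\partial L}{\partial\mathbf u}$ and $L^{*,\rho}=\rho\dfrac{\partial L}{\partial\rho}-L$, the following equations of motion hold in $\Omega$: $$\begin{cases} \partial_tM+\operatorname{div}(M\mathbf u)-\dfrac{\partial L}{\partial\alpha}=0,\\ \partial_tP+\operatorname{div}(P\mathbf u)-\dfrac{\partial L}{\partial a_{\mathrm i}}=0,\\ \partial_tK+\operatorname{div}(K\mathbf u)-\nabla L^{*,\rho}=0. \end{cases}$$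
   Context: $\Omega=\{(t,\mathbf x): t_1\le t\le t_2,\ \mathbf x\in\omega(t)\}$, where $\omega(t)\subset\mathbb R^3$ is the (regular) volume occupied by the fluid-interface system. $\mathrm D_t=\partial_t+\mathbf u\cdot\nabla$; $\operatorname{div},\nabla$ are in $\mathbf x$; $\operatorname{div}(K\mathbf u)$ has components $\sum_j\partial_j(K_iu_j)$. Here $\rho>0$ is the density, $\mathbf u$ the velocity, $y\in(0,1)$ and $\alpha\in(0,1)$ the mass and volume fractions of phase 1, $a_{\mathrm i}>0$ the interfacial area density, $s,s_1,s_2$ specific entropies of the mixture and of the phases. The Lagrangian is the function of the independent variables $\mathbf B=\{\rho,s,s_1,s_2,a_{\mathrm i},y,\alpha,\mathbf u,\mathrm D_t\alpha,\mathrm D_ta_{\mathrm i}\}$ $$L(\mathbf B)=\tfrac12\rho|\mathbf u|^2+\tfrac m2|\mathrm D_t\alpha|^2+\tfrac\nu2|\mathrm D_ta_{\mathrm i}|^2-\rho\,e,$$ $m,\nu>0$ constants, with $$e=y\,e_1\Big(\frac{\alpha}{y\rho},s_1\Big)+(1-y)\,e_2\Big(\frac{1-\alpha}{(1-y)\rho},s_2\Big)+\frac{a_{\mathrm i}}{\rho}\,e_{\mathrm i}\Big(\frac{\rho\,(s-ys_1-(1-y)s_2)}{a_{\mathrm i}}\Big),$$ where $e_1,e_2,e_{\mathrm i}$ are given smooth energy functions. Partial derivatives of $L$ are taken with respect to the variables in $\mathbf B$. Admissible variations: let $\delta\mathbf x:\Omega\to\mathbb R^3$ (infinitesimal displacement)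 and $\delta\alpha,\delta a_{\mathrm i}:\Omega\to\mathbb R$ be arbitrary, independent smooth functions vanishing on $\partial\Omega$. The Eulerian variations (at fixed $(t,\mathbf x)$) of the other variables, compatible with the conservation constraints, are $$\delta\rho=-\operatorname{div}(\rho\,\delta\mathbf x),\qquad \delta\mathbf u=\mathrm D_t(\delta\mathbf x)-(\delta\mathbf x\cdot\nabla)\mathbf u,\qquad \delta b=-\nabla b\cdot\delta\mathbf x\ \text{ for } b\in\{s,s_1,s_2,y\},$$ and, for $f\in\{\alpha,a_{\mathrm i}\}$, $\delta(\mathrm D_tf)=\partial_t(\delta f)+\mathbf u\cdot\nabla(\delta f)+\delta\mathbf u\cdot\nabla f$. *)

(* Defs.v *)
From HB Require Import structures.
From mathcomp Require Import all_boot all_order all_algebra.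
From mathcomp Require Import all_classical all_reals all_analysis.

Set Implicit Arguments.
Unset Strict Implicit.
Unset Printing Implicit Defensive.

Import Order.TTheory GRing.Theory Num.Theory.
Import numFieldNormedType.Exports.

Local Open Scope classical_set_scope.
Local Open Scope ring_scope.

(* Points (t, x) of R x R^3. *)
Notation space_time R := (R * 'rV[R]_3)%type.

Section smoothness.
Context {R : realType} {V W : normedModType R}.

(* Class C^k on an open set. In finite dimension (the only case used), a map is
   C^(k+1) iff it is differentiable with C^k directional derivatives. *)
Fixpoint Ck_on (k : nat) (U : set V) (f : V -> W) : Prop :=
  match k with
  | 0%N => forall x, U x -> {for x, continuous f}
  | k'.+1 => (forall x, U x -> differentiable f x) /\
             (forall v : V, Ck_on k' U (fun x => 'D_v f x))
  end.

(* Smooth up to the boundary: C^infinity on an open neighbourhood of A, so that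
   the derivatives make sense at every point of A. *)
Definition smooth_on (A : set V) (f : V -> W) : Prop :=
  exists U : set V, [/\ open U, A `<=` U & forall k : nat, Ck_on k U f].

End smoothness.

Section calculus.
Context {R : realType}.
Implicit Types (p q : space_time R) (u w K : space_time R -> 'rV[R]_3).

Definition dt {W : normedModType R} (f : space_time R -> W) p : W :=
  'D_((1, 0) : space_time R) f p.

Definition dx {W : normedModType R} (j : 'I_3) (f : space_time R -> W) p : W :=
  'D_((0, delta_mx 0 j) : space_time R) f p.

Definition grad (f : space_time R -> R) p : 'rV[R]_3 := \row_(j < 3) dx j f p.

Definition div w p : R := \sum_(j < 3) dx j (fun q => w q 0 j) p.

(* div (K u), with components sum_j d_j (K_i u_j) *)
Definition div_tensor K u p : 'rV[R]_3 :=
  \row_(i < 3) \sum_(j < 3) dx j (fun q => K q 0 i * u q 0 j) p.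

(* (w . grad) f, for scalar or vector valued f *)
Definition advect {W : normedModType R} w (f : space_time R -> W) p : W :=
  \sum_(j < 3) w p 0 j *: dx j f p.

Definition Dt {W : normedModType R} u (f : space_time R -> W) p : W :=
  dt f p + advect u f p.

End calculus.

Section domain.
Context {R : realType}.

Definition space_time_domain (t1 t2 : R) (omega : R -> set 'rV[R]_3) :
    set (space_time R) :=
  [set p | t1 <= p.1 <= t2 /\ omega p.1 p.2].

(* A compact set that is the closure of its interior. *)
Definition regular_domain (Omega : set (space_time R)) : Prop :=
  compact Omega /\ closure (interior Omega) = Omega.

Definition boundary (Omega : set (space_time R)) : set (space_time R) :=
  closure Omega `\` interior Omega.

Definition of_coords (q : R * (R * (R * R))) : space_time R :=
  (q.1, \row_(j < 3) [:: q.2.1; q.2.2.1; q.2.2.2]`_j).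

Local Notation lambda := (@lebesgue_measure R).

(* The library puts no measure on 'rV_3, so the Lebesgue integral dx dt is
   taken in coordinates, for the product measure on R x (R x (R x R)). *)
Definition integral_over (Omega : set (space_time R))
    (F : space_time R -> R) : \bar R :=
  (\int[lambda \x (lambda \x (lambda \x lambda))]_(q in of_coords @^-1` Omega)
     (F (of_coords q))%:E)%E.

End domain.

(* The independent variables B of the Lagrangian form a row vector: 9 scalars
   followed by the 3 components of the velocity. *)
Notation nvar := (9 + 3)%N.

Definition i_rho : 'I_nvar := lshift 3 (@Ordinal 9 0 isT).
Definition i_s : 'I_nvar := lshift 3 (@Ordinal 9 1 isT).
Definition i_s1 : 'I_nvar := lshift 3 (@Ordinal 9 2 isT).
Definition i_s2 : 'I_nvar := lshift 3 (@Ordinal 9 3 isT).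
Definition i_ai : 'I_nvar := lshift 3 (@Ordinal 9 4 isT).
Definition i_y : 'I_nvar := lshift 3 (@Ordinal 9 5 isT).
Definition i_alpha : 'I_nvar := lshift 3 (@Ordinal 9 6 isT).
Definition i_Dalpha : 'I_nvar := lshift 3 (@Ordinal 9 7 isT).
Definition i_Dai : 'I_nvar := lshift 3 (@Ordinal 9 8 isT).
Definition i_u (j : 'I_3) : 'I_nvar := rshift 9 j.

Section lagrangian.
Context {R : realType}.
Implicit Types (B : 'rV[R]_nvar).

Definition mk_vars (rho s s1 s2 ai y alpha Dalpha Dai : R) (u : 'rV[R]_3) :
    'rV[R]_nvar :=
  row_mx (\row_(k < 9) [:: rho; s; s1; s2; ai; y; alpha; Dalpha; Dai]`_k) u.

Definition energy (e1 e2 : R -> R -> R) (ei : R -> R)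
    (rho s s1 s2 ai y alpha : R) : R :=
  y * e1 (alpha / (y * rho)) s1
  + (1 - y) * e2 ((1 - alpha) / ((1 - y) * rho)) s2
  + ai / rho * ei (rho * (s - y * s1 - (1 - y) * s2) / ai).

Definition lagrangian (m nu : R) (e1 e2 : R -> R -> R) (ei : R -> R) B : R :=
  2^-1 * B 0 i_rho * (\sum_(j < 3) B 0 (i_u j) ^+ 2)
  + m / 2 * `|B 0 i_Dalpha| ^+ 2
  + nu / 2 * `|B 0 i_Dai| ^+ 2
  - B 0 i_rho * energy e1 e2 ei (B 0 i_rho) (B 0 i_s) (B 0 i_s1) (B 0 i_s2)
                  (B 0 i_ai) (B 0 i_y) (B 0 i_alpha).

(* Partial derivative of L with respect to the b-th independent variable. *)
Definition partial (b : 'I_nvar) (L : 'rV[R]_nvar -> R) B : R :=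
  'D_(delta_mx 0 b) L B.

Definition partial_u (L : 'rV[R]_nvar -> R) B : 'rV[R]_3 :=
  \row_(j < 3) partial (i_u j) L B.

(* L^{*,rho} *)
Definition legendre_rho (L : 'rV[R]_nvar -> R) B : R :=
  B 0 i_rho * partial i_rho L B - L B.

End lagrangian.

Record flow (R : realType) := Flow {
  density : space_time R -> R;
  entropy : space_time R -> R;
  entropy1 : space_time R -> R;
  entropy2 : space_time R -> R;
  area : space_time R -> R;
  massfrac : space_time R -> R;
  volfrac : space_time R -> R;
  velocity : space_time R -> 'rV[R]_3
}.

Section flow_theory.
Context {R : realType}.
Implicit Types (Omega : set (space_time R)) (B : flow R) (p : space_time R).

(* The fields of B together with D_t alpha and D_t a_i. *)
Definition state B p : 'rV[R]_nvar :=
  mk_vars (density B p) (entropy B p) (entropy1 B p) (entropy2 B p) (area B p)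
    (massfrac B p) (volfrac B p)
    (Dt (velocity B) (volfrac B) p) (Dt (velocity B) (area B) p) (velocity B p).

Definition smooth_flow Omega B : Prop :=
  [/\ smooth_on Omega (density B),
      [/\ smooth_on Omega (entropy B), smooth_on Omega (entropy1 B)
        & smooth_on Omega (entropy2 B)],
      smooth_on Omega (area B) /\ smooth_on Omega (massfrac B),
      smooth_on Omega (volfrac B)
    & smooth_on Omega (velocity B)].

Definition physical_flow Omega B : Prop :=
  forall p, Omega p ->
    [/\ 0 < density B p, 0 < area B p, 0 < massfrac B p < 1 & 0 < volfrac B p < 1].

Definition conservation_laws Omega B : Prop :=
  forall p, Omega p ->
    [/\ dt (density B) p + div (fun q => density B q *: velocity B q) p = 0,
        Dt (velocity B) (massfrac B) p = 0,
        Dt (velocity B) (entropy B) p = 0,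
        Dt (velocity B) (entropy1 B) p = 0
      & Dt (velocity B) (entropy2 B) p = 0].

(* Eulerian variations generated by the displacement xi (delta x) and by
   dalpha, dai (delta alpha, delta a_i). *)
Definition delta_rho B (xi : space_time R -> 'rV[R]_3) p : R :=
  - div (fun q => density B q *: xi q) p.

Definition delta_u B (xi : space_time R -> 'rV[R]_3) p : 'rV[R]_3 :=
  Dt (velocity B) xi p - advect xi (velocity B) p.

Definition delta_transported (b : space_time R -> R)
    (xi : space_time R -> 'rV[R]_3) p : R :=
  - advect xi b p.

Definition delta_Dt B (f : space_time R -> R) (xi : space_time R -> 'rV[R]_3)
    (df : space_time R -> R) p : R :=
  dt df p + advect (velocity B) df p + advect (delta_u B xi) f p.

Definition delta_state B (xi : space_time R -> 'rV[R]_3)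
    (dalpha dai : space_time R -> R) p : 'rV[R]_nvar :=
  mk_vars (delta_rho B xi p)
    (delta_transported (entropy B) xi p) (delta_transported (entropy1 B) xi p)
    (delta_transported (entropy2 B) xi p)
    (dai p) (delta_transported (massfrac B) xi p) (dalpha p)
    (delta_Dt B (volfrac B) xi dalpha p) (delta_Dt B (area B) xi dai p)
    (delta_u B xi p).

Definition test_function {W : normedModType R} Omega
    (f : space_time R -> W) : Prop :=
  smooth_on Omega f /\ (forall p, boundary Omega p -> f p = 0).

Definition stationary Omega (L : 'rV[R]_nvar -> R) B : Prop :=
  forall (xi : space_time R -> 'rV[R]_3) (dalpha dai : space_time R -> R),
    test_function Omega xi -> test_function Omega dalpha ->
    test_function Omega dai ->
    integral_over Omega (fun p =>
      \sum_(b < nvar) partial b L (state B p) * delta_state B xi dalpha dai p 0 b)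
    = 0%E.

End flow_theory.

(* Main.v *)
Require Import Defs.
From HB Require Import structures.
From mathcomp Require Import all_boot all_order all_algebra.
From mathcomp Require Import all_classical all_reals all_analysis.
From mathcomp Require Import ring lra.

Set Implicit Arguments.
Unset Strict Implicit.
Unset Printing Implicit Defensive.

Import Order.TTheory GRing.Theory Num.Theory.
Import numFieldNormedType.Exports.

Local Open Scope classical_set_scope.
Local Open Scope ring_scope.

(* Displace the fluid by [xi = phi e_i] and let [alpha] and [a_i] be transported
   passively, i.e. [delta alpha = - xi . grad alpha] and
   [delta a_i = - xi . grad a_i].  Since second derivatives commute,
   [delta (D_t alpha) = - xi . grad (D_t alpha)], so every variable varies by
   minus its derivative along [xi], except for the extra terms [- rho d_i phi] in
   [delta rho] and [(D_t phi) e_i] in [delta u].  By the chain rule the integrand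
   of the first variation is then
     [- phi d_i L - rho L_rho d_i phi + K_i D_t phi],
   which is a space-time divergence minus [phi] times the i-th component of the
   momentum equation, with [L^{*,rho}] appearing directly.  The equations for
   [M] and [P] come in the same way from [delta alpha = phi] and
   [delta a_i = phi] alone.  For a bump function [phi] supported in the interior
   of [Omega] the divergence integrates to zero (Fubini and the fundamental
   theorem of calculus), whence the equations in the interior; they extend to
   [Omega] by continuity because [Omega] is the closure of its interior. *)

(** * Calculus of C^k maps *)

(** Nothing is known about the boundary of [Omega], so the divergence theorem on [Omega] is avoided.
    With [phi] supported in a closed cube inside [Omega] the integrand vanishes off [Omega], the
    integral extends to the whole of R^4, and each term of the divergence is integrated along its
    own coordinate line. Compactness of [Omega] bounds the integrands, which makes Fubini
    applicable. Passive transport of [alpha] and [a_i] keeps the equations for [M] and [P] out of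
    the momentum equation: with [delta alpha = delta a_i = 0] the displacement would leave terms in
    [grad alpha] and [grad a_i] that only those equations remove. The fields are smooth on
    neighbourhoods of [Omega] only, and [L] only where the state is physical, so the computations
    run on one open set [V] containing [Omega] where both hold. Smoothness means iterated
    directional differentiability; closure of C^k under the operations in [L] and the symmetry of
    second derivatives are derived from that form. *)

Section Ck_calculus.
Context {R : realType}.
Implicit Types V W : normedModType R.

Lemma Ck_on_diff V W k (U : set V) (f : V -> W) x :
  Ck_on k.+1 U f -> U x -> differentiable f x.
Proof. by move=> [h _] Ux; exact: h. Qed.

Lemma Ck_on_derive V W k (U : set V) (f : V -> W) v :
  Ck_on k.+1 U f -> Ck_on k U ('D_v f).
Proof. by move=> [_]; exact. Qed.

Lemma Ck_on_continuous V W k (U : set V) (f : V -> W) x :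
  Ck_on k U f -> U x -> {for x, continuous f}.
Proof.
case: k => [h|k [h _]] Ux; first exact: h.
exact/differentiable_continuous/h.
Qed.

Lemma Ck_onW V W k (U : set V) (f : V -> W) : Ck_on k.+1 U f -> Ck_on k U f.
Proof.
elim: k f => [|k IH] f fC; first by move=> x; exact: Ck_on_continuous fC.
by case: fC => fd fC; split=> // v; exact/IH/fC.
Qed.

Lemma Ck_on_sub V W k (U U' : set V) (f : V -> W) :
  U' `<=` U -> Ck_on k U f -> Ck_on k U' f.
Proof.
move=> UU; elim: k f => [|k IH] f /=; first by move=> h x /UU; exact: h.
by move=> [fd fC]; split=> [x /UU|v]; [exact: fd | exact/IH/fC].
Qed.

Lemma Ck_on_setU V W k (U U' : set V) (f : V -> W) :
  Ck_on k U f -> Ck_on k U' f -> Ck_on k (U `|` U') f.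
Proof.
elim: k f => [|k IH] f /=; first by move=> h h' x []; [exact: h | exact: h'].
by move=> [d c] [d' c']; split=> [x []|v]; [exact: d | exact: d' | exact: IH].
Qed.

(** The first-order expansion of [f] at [x] is also one of [g], because the two error terms agree
    near 0; uniqueness of the differential then identifies ['d g x] with ['d f x]. *)
Lemma near_eq_differentiable V W (f g : V -> W) x :
  {near x, f =1 g} -> differentiable f x -> differentiable g x.
Proof.
move=> fg df; have fgx : f x = g x by exact: nbhs_singleton fg.
have gE : g \o shift x = cst (g x) + 'd f x +o_ 0 id.
  apply/eqaddoP => _/posnumP[e].
  have := diff_locally df => /eqaddoP/(_ e%:num) /(_ [gt0 of e%:num]).
  have : \forall h \near 0, f (h + x) = g (h + x).
    have : \forall y \near x, f y = g y by exact: fg.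
    by rewrite (near_shift 0) subr0.
  apply: filterS2 => h fgh.
  by rewrite !fctE /= fgh fgx.
have dgE := diff_unique (diff_continuous df) gE.
by apply/diff_locallyP; rewrite dgE; split=> //; exact: diff_continuous.
Qed.

(** Openness of [U] turns equality on [U] into equality near each of its points, so the directional
    derivatives agree on [U] as well and the induction proceeds. *)
Lemma Ck_on_ext V W k (U : set V) (f g : V -> W) :
  open U -> {in U, f =1 g} -> Ck_on k U f -> Ck_on k U g.
Proof.
move=> oU; have nU x : U x -> \forall y \near x, U y.
  by move=> Ux; apply: open_nbhs_nbhs.
have fgn (f' g' : V -> W) : {in U, f' =1 g'} ->
    forall x, U x -> {near x, f' =1 g'}.
  by move=> fg x /nU; apply: filterS => y /mem_set; exact: fg.
elim: k f g => [|k IH] f g fg /=.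
  move=> fc x Ux; have fgx := fgn _ _ fg x Ux.
  rewrite /prop_for /continuous_at -(nbhs_singleton fgx).
  by apply: cvg_trans (fc x Ux); exact: near_eq_cvg.
move=> [fd fC]; split=> [x Ux|v].
  by apply: near_eq_differentiable (fd x Ux); exact: fgn.
apply: IH (fC v) => x /set_mem Ux.
by apply: near_eq_derive; exact: fgn.
Qed.

Lemma Ck_on_cst V W k (U : set V) (c : W) : Ck_on k U (fun=> c).
Proof.
elim: k c => [|k IH] c /=; first by move=> x _; exact: cvg_cst.
split=> [x _|v]; first exact: differentiable_cst.
have -> : (fun x : V => 'D_v (fun=> c) x) = (fun=> 0).
  by apply/funext => x; rewrite derive_cst.
exact: IH.
Qed.

(** ['D_v] commutes with a continuous linear map, so the induction keeps the same [l]. Negation,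
    multiples of a fixed vector and coordinates are instances. *)
Lemma Ck_on_linear_comp V W W' k (U : set V) (l : {linear W -> W'})
    (f : V -> W) :
  open U -> continuous l -> Ck_on k U f -> Ck_on k U (l \o f).
Proof.
move=> oU lc; elim: k f => [|k IH] f /=.
  by move=> fc x Ux; apply: continuous_comp; [exact: fc | exact: lc].
move=> [fd fC]; split=> [x Ux|v].
  by apply: differentiable_comp; [exact: fd | exact: linear_differentiable].
apply: Ck_on_ext (IH _ (fC v)) => // x /set_mem Ux /=.
have df := fd x Ux; have dl : differentiable l (f x) by exact: linear_differentiable.
rewrite (deriveE _ (differentiable_comp df dl)) (deriveE _ df).
by rewrite (diff_comp df dl) /= (diff_lin _ lc).
Qed.

Lemma Ck_on_linear V W k (U : set V) (l : {linear V -> W}) :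
  continuous l -> Ck_on k U l.
Proof.
move=> lc; apply: (@Ck_on_sub _ _ _ setT) => //; case: k => [|k] /=.
  by move=> x _; exact: lc.
split=> [x _|v]; first exact: linear_differentiable.
have -> : (fun x : V => 'D_v l x) = (fun=> l v).
  by apply/funext => x; rewrite deriveE ?diff_lin//; exact: linear_differentiable.
exact: Ck_on_cst.
Qed.

Lemma Ck_onD V W k (U : set V) (f g : V -> W) :
  open U -> Ck_on k U f -> Ck_on k U g -> Ck_on k U (fun x => f x + g x).
Proof.
move=> oU; elim: k f g => [|k IH] f g /=.
  by move=> fc gc x Ux; apply: continuousD; [exact: fc | exact: gc].
move=> [fd fC] [gd gC]; split=> [x Ux|v].
  by apply: differentiableD; [exact: fd | exact: gd].
apply: Ck_on_ext (IH _ _ (fC v) (gC v)) => // x /set_mem Ux /=.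
by rewrite [RHS]deriveD//; apply: diff_derivable; [exact: fd | exact: gd].
Qed.

Lemma Ck_onM V k (U : set V) (f g : V -> R) :
  open U -> Ck_on k U f -> Ck_on k U g -> Ck_on k U (fun x => f x * g x).
Proof.
move=> oU; elim: k f g => [|k IH] f g.
  by move=> /= fc gc x Ux; apply: continuousM; [exact: fc | exact: gc].
move=> fC gC; split=> [x Ux|v].
  by apply: differentiableM; [exact: (Ck_on_diff fC)|exact: (Ck_on_diff gC)].
apply: (@Ck_on_ext _ _ _ _ (fun x => f x * 'D_v g x + g x * 'D_v f x)) => //.
  move=> x /set_mem Ux /=; rewrite [RHS]deriveM//; apply: diff_derivable.
  - exact: (Ck_on_diff fC).
  - exact: (Ck_on_diff gC).
by apply: Ck_onD => //; apply: IH;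
  first [exact: Ck_onW | exact: Ck_on_derive].
Qed.

Lemma Ck_on_sum V W k (U : set V) n (f : 'I_n -> V -> W) :
  open U -> (forall i, Ck_on k U (f i)) ->
  Ck_on k U (fun x => \sum_(i < n) f i x).
Proof.
move=> oU; elim: n f => [|n IH] f fC.
  rewrite (_ : (fun _ => _) = (fun=> 0)); first exact: Ck_on_cst.
  by apply/funext => x; rewrite big_ord0.
rewrite (_ : (fun _ => _) =
  (fun x => f ord0 x + \sum_(i < n) f (lift ord0 i) x)).
  by apply: Ck_onD => //; exact: IH.
by apply/funext => x; rewrite big_ord_recl.
Qed.

Lemma Ck_onN V W k (U : set V) (f : V -> W) :
  open U -> Ck_on k U f -> Ck_on k U (fun x => - f x).
Proof.
move=> oU fC; apply: (Ck_on_linear_comp (l := -%R)) fC => //.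
exact: opp_continuous.
Qed.

Lemma Ck_onB V W k (U : set V) (f g : V -> W) :
  open U -> Ck_on k U f -> Ck_on k U g -> Ck_on k U (fun x => f x - g x).
Proof. by move=> oU fC gC; apply: Ck_onD => //; exact: Ck_onN. Qed.

Lemma Ck_onZl V W k (U : set V) (f : V -> R) (w : W) :
  open U -> Ck_on k U f -> Ck_on k U (fun x => f x *: w).
Proof.
move=> oU fC.
have lin : linear ( *:%R ^~ w : R -> W) by move=> a x y; rewrite scalerDl scalerA.
pose lM := GRing.isLinear.Build _ _ _ _ _ lin.
pose l : {linear R -> W} := HB.pack ( *:%R ^~ w) lM.
apply: (Ck_on_linear_comp (l := l)) fC => //.
exact: scalel_continuous.
Qed.

Lemma Ck_onX V k (U : set V) (f : V -> R) n :
  open U -> Ck_on k U f -> Ck_on k U (fun x => f x ^+ n).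
Proof.
move=> oU fC; elim: n => [|n IH]; first exact: Ck_on_cst.
rewrite (_ : (fun _ => _) = (fun x => f x * f x ^+ n)); first exact: Ck_onM.
by apply/funext => x; rewrite exprS.
Qed.

Lemma Ck_on_coord V k (U : set V) n (f : V -> 'rV[R]_n) j :
  open U -> Ck_on k U f -> Ck_on k U (fun x => f x 0 j).
Proof.
move=> oU fC.
have lin : linear (fun N : 'rV[R]_n => N 0 j : R) by move=> a x y; rewrite !mxE.
pose lM := GRing.isLinear.Build _ _ _ _ _ lin.
pose l : {linear 'rV[R]_n -> R} := HB.pack (fun N : 'rV[R]_n => N 0 j : R) lM.
apply: (Ck_on_linear_comp (l := l)) fC => //.
exact: coord_continuous.
Qed.

Lemma Ck_on_row V k (U : set V) n (f : V -> 'rV[R]_n) :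
  open U -> (forall j, Ck_on k U (fun x => f x 0 j)) -> Ck_on k U f.
Proof.
move=> oU fC.
rewrite (_ : f = (fun x => \sum_(j < n) f x 0 j *: delta_mx 0 j)).
  by apply: Ck_on_sum => // j; exact: Ck_onZl.
by apply/funext => x; rewrite -row_sum_delta.
Qed.

(* [l] gives the coordinates of vectors of [V'] in the basis [e]. *)
Lemma Ck_on_comp_basis V V' k (U : set V) (U' : set V') n (e : 'I_n -> V')
    (l : 'I_n -> {linear V' -> R}) (f : V -> V') (g : V' -> R) :
  open U -> (forall i, continuous (l i)) ->
  (forall w, w = \sum_(i < n) l i w *: e i) ->
  (forall x, U x -> U' (f x)) ->
  Ck_on k U f -> Ck_on k U' g -> Ck_on k U (g \o f).
Proof.
move=> oU lc le UU'; elim: k g => [|k IH] g.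
  by move=> /= fc gc x Ux; apply: continuous_comp; [exact: fc | exact/gc/UU'].
move=> fC gC; split=> [x Ux|v].
  by apply: differentiable_comp;
    [exact: (Ck_on_diff fC)|apply: (Ck_on_diff gC); exact: UU'].
apply: (@Ck_on_ext _ _ _ _
    (fun x => \sum_(i < n) (l i \o 'D_v f) x * ('D_(e i) g \o f) x)) => //.
  move=> x /set_mem Ux /=.
  have df := Ck_on_diff fC Ux.
  have dg := Ck_on_diff gC (UU' _ Ux).
  have dgf : differentiable (g \o f) x by exact: differentiable_comp.
  rewrite (deriveE _ dgf) diff_comp//= -(deriveE _ df) [in RHS](le ('D_v f x)).
  rewrite raddf_sum; apply: eq_bigr => i _.
  by rewrite [RHS]linearZ/= (deriveE _ dg).
apply: Ck_on_sum => // i; apply: Ck_onM => //.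
  by apply: Ck_on_linear_comp => //; exact: Ck_on_derive.
by apply: IH; [exact: Ck_onW | exact: Ck_on_derive].
Qed.

Lemma Ck_on_comp_row V k n (U : set V) (U' : set 'rV[R]_n) (f : V -> 'rV[R]_n)
    (g : 'rV[R]_n -> R) :
  open U -> (forall x, U x -> U' (f x)) ->
  Ck_on k U f -> Ck_on k U' g -> Ck_on k U (g \o f).
Proof.
move=> oU.
have lin j : linear (fun N : 'rV[R]_n => N 0 j : R) by move=> a x y; rewrite !mxE.
pose lM j := GRing.isLinear.Build _ _ _ _ _ (lin j).
pose l j : {linear 'rV[R]_n -> R} := HB.pack (fun N : 'rV[R]_n => N 0 j : R) (lM j).
move=> UU' fC gC.
apply: (@Ck_on_comp_basis V 'rV[R]_n k U U' n (delta_mx 0) l f g oU) => //.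
- by move=> i; exact: coord_continuous.
- by move=> w; rewrite [LHS]row_sum_delta.
Qed.

Lemma Ck_on_comp V k (U : set V) (U' : set R) (f : V -> R) (g : R -> R) :
  open U -> (forall x, U x -> U' (f x)) ->
  Ck_on k U f -> Ck_on k U' g -> Ck_on k U (g \o f).
Proof.
move=> oU; pose l (_ : 'I_1) : {linear R -> R} := idfun.
move=> UU' fC gC.
apply: (@Ck_on_comp_basis V R k U U' 1 (fun=> 1) l f g oU) => //.
- by move=> i x; exact: cvg_id.
- by move=> w; rewrite big_ord1 /= /GRing.scale /= mulr1.
Qed.

Lemma Ck_on_comp_pair V k (U : set V) (U' : set (R * R)) (f1 f2 : V -> R)
    (g : R -> R -> R) :
  open U -> (forall x, U x -> U' (f1 x, f2 x)) ->
  Ck_on k U f1 -> Ck_on k U f2 -> Ck_on k U' (fun v => g v.1 v.2) ->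
  Ck_on k U (fun x => g (f1 x) (f2 x)).
Proof.
move=> oU UU' f1C f2C gC.
pose e (i : 'I_2) : R * R := if i == 0 then (1, 0) else (0, 1).
pose l1 : {linear (R * R)%type -> R} := fst.
pose l2 : {linear (R * R)%type -> R} := snd.
pose l (i : 'I_2) := if i == 0 then l1 else l2.
have fE x : (f1 x, f2 x) = f1 x *: ((1, 0) : R * R) + f2 x *: ((0, 1) : R * R).
  by congr (_, _); rewrite /= /GRing.scale/= ?mulr1 ?mulr0 ?addr0 ?add0r.
apply: (@Ck_on_comp_basis V (R * R)%type k U U' 2 e l (fun x => (f1 x, f2 x))
  (fun v => g v.1 v.2) oU) => //.
- by move=> i; rewrite /l; case: ifP => _ x; [exact: cvg_fst|exact: cvg_snd].
- move=> [a b]; rewrite big_ord_recl big_ord1 /l /e /=.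
  by congr (_, _); rewrite /= /GRing.scale/= ?mulr1 ?mulr0 ?addr0 ?add0r.
- rewrite (_ : (fun _ => _) =
    (fun x => f1 x *: ((1, 0) : R * R) + f2 x *: ((0, 1) : R * R))); last exact/funext.
  by apply: Ck_onD => //; exact: Ck_onZl.
Qed.

(** The derivative of inversion is a polynomial in inversion, so the induction closes on itself. *)
Lemma Ck_on_inv k : Ck_on k [set x : R | x != 0] GRing.inv.
Proof.
have oU : open [set x : R | x != 0] by exact: open_neq.
elim: k => [|k IH]; first by move=> x /= x0; exact: inv_continuous.
split=> [x /= x0|v]; first exact: differentiable_Rinv.
apply: (@Ck_on_ext _ _ _ _ (fun x : R => - (v * x^-1 ^+ 2))) => //.
  move=> x /set_mem /= x0.
  rewrite deriveE; last exact: differentiable_Rinv.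
  by rewrite diff_Rinv// /GRing.scale/= exprVn mulNr mulrC.
apply: Ck_onN => //; apply: Ck_onM => //; first exact: Ck_on_cst.
exact: Ck_onX.
Qed.

Lemma Ck_onV V k (U : set V) (f : V -> R) :
  open U -> (forall x, U x -> f x != 0) -> Ck_on k U f ->
  Ck_on k U (fun x => (f x)^-1).
Proof. by move=> oU f0 fC; exact: (Ck_on_comp oU f0 fC (Ck_on_inv k)). Qed.

End Ck_calculus.

(** * Schwarz's theorem on mixed second derivatives *)

Section symmetry_of_second_derivatives.
Context {R : realType} {V : normedModType R}.
Implicit Types (f : V -> R) (x a v w : V).

(** On a line a directional derivative becomes an ordinary one, to which the mean value theorem and
    the fundamental theorem of calculus apply. *)
Lemma is_derive_line f a v (s : R) : derivable f (a + s *: v) v ->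
  is_derive s 1 (fun r : R => f (a + r *: v)) ('D_v f (a + s *: v)).
Proof.
move=> fd; have E : (fun h : R => h^-1 *:
    (((fun r : R => f (a + r *: v)) \o shift s) (h *: 1) - f (a + s *: v))) =
  (fun h => h^-1 *: ((f \o shift (a + s *: v)) (h *: v) - f (a + s *: v))).
  apply/funext => h /=; congr (_ *: (f _ - _)).
  have -> : h *: (1 : R) = h by exact: mulr1.
  by rewrite scalerDl addrCA.
by split; rewrite /derivable /derive E.
Qed.

Lemma mean_value_line f a v (h : R) : 0 < h ->
  (forall s, 0 <= s <= h -> differentiable f (a + s *: v)) ->
  exists2 s, 0 < s < h & f (a + h *: v) - f a = h * 'D_v f (a + s *: v).
Proof.
move=> h0 df.
have dl s : 0 <= s <= h ->
    is_derive s 1 (fun r : R => f (a + r *: v)) ('D_v f (a + s *: v)).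
  by move=> sh; apply: is_derive_line; exact/diff_derivable/df.
have [||s sh E] := @MVT R (fun r : R => f (a + r *: v))
  (fun r => 'D_v f (a + r *: v)) 0 h h0.
- by move=> s; rewrite in_itv/= => /andP[s0 sh]; apply: dl; rewrite !ltW.
- apply: derivable_within_continuous => s.
  by rewrite in_itv/= => sh; case: (dl s sh).
- move: E; rewrite scale0r addr0 subr0 mulrC => E; exists s => //.
Qed.

(** The left side is [g (x + h *: v) - g x] for [g z = f (z + h *: w) - f z]. The mean value theorem
    is applied to [g] along [v], then to ['D_v f] along [w]. *)
Lemma second_difference f x v w (N : set V) : open N -> N x -> Ck_on 2 N f ->
  \forall h \near 0^'+, exists2 xi, N xi &
    f (x + h *: v + h *: w) - f (x + h *: v) - f (x + h *: w) + f x =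
    h ^+ 2 * 'D_w ('D_v f) xi.
Proof.
move=> oN Nx fC.
have /nbhs_ballP[e /= e0 eN] : nbhs x N by exact: open_nbhs_nbhs.
near=> h.
have h0 : 0 < h by near: h; exact: nbhs_right_gt.
have he : h * (`|v| + `|w|) < e.
  (* The [+ 1] keeps the divisor positive when [v] and [w] both vanish. *)
  apply: (@le_lt_trans _ _ (h * (`|v| + `|w| + 1))).
    by rewrite ler_wpM2l ?lerDl// ltW.
  rewrite -ltr_pdivlMr; last by rewrite ltr_wpDl// addr_ge0.
  by near: h; apply: nbhs_right_lt; rewrite divr_gt0// ltr_wpDl// addr_ge0.
(* The whole parallelogram spanned by [h *: v] and [h *: w] at [x] lies in [N]. *)
have inN s r : 0 <= s <= h -> 0 <= r <= h -> N (x + s *: v + r *: w).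
  move=> /andP[s0 sh] /andP[r0 rh]; apply: eN; rewrite -ball_normE /=.
  rewrite -addrA opprD addNKr normrN; apply: le_lt_trans he.
  rewrite (le_trans (ler_normD _ _))// !normrZ !ger0_norm// mulrDr.
  by rewrite lerD// ler_wpM2r.
have fd y : N y -> differentiable f y by exact: (Ck_on_diff fC).
have sd c y : N (y + c) -> differentiable (fun z => f (z + c)) y.
  move=> Nyc; apply: (@differentiable_comp _ _ _ _ (fun z => z + c)); last exact: fd.
  by apply: differentiableD.
have sE c y : 'D_v (fun z => f (z + c)) y = 'D_v f (y + c).
  by rewrite /derive; under eq_fun do rewrite /= -addrA.
pose g z := f (z + h *: w) - f z.
have hh : 0 <= h <= h by rewrite lexx ltW.
have z0h : 0 <= (0 : R) <= h by rewrite lexx ltW.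
have gd s : 0 <= s <= h ->
    differentiable (fun z => f (z + h *: w)) (x + s *: v) /\
    differentiable f (x + s *: v).
  move=> sh; split; first exact/sd/inN.
  by apply: fd; have := inN s 0 sh z0h; rewrite scale0r addr0.
have [|s /andP[s0 sh] gE] := @mean_value_line g x v h h0.
  by move=> s /gd[d1 d2]; exact: differentiableB.
have sI : 0 <= s <= h by rewrite !ltW.
have [|r /andP[r0 rh] rE] := @mean_value_line ('D_v f) (x + s *: v) w h h0.
  move=> r rI; apply: (Ck_on_diff (Ck_on_derive v fC)); exact: inN.
exists (x + s *: v + r *: w); first by apply: inN; rewrite // !ltW.
have [d1 d2] := gd s sI.
move: gE; rewrite /g deriveB; [|exact: diff_derivable..].
rewrite sE rE expr2 -mulrA => <-.
by rewrite opprB addrA addrAC.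
Unshelve. all: by end_near. Qed.

(** The second difference is symmetric in [v] and [w], so the two mixed derivatives take a common
    value at points [xi] and [eta] near [x]; continuity carries the equality to [x] up to an
    arbitrary [e]. *)
Lemma derive_symmetric f x v w (U : set V) : open U -> U x -> Ck_on 2 U f ->
  'D_w ('D_v f) x = 'D_v ('D_w f) x.
Proof.
move=> oU Ux fC; apply/eqP; rewrite -subr_eq0 -normr_eq0; apply/eqP.
apply/eqP; rewrite eq_le normr_ge0 andbT; apply/ler_addgt0Pl => e e0; rewrite addr0.
have cvw : {for x, continuous ('D_w ('D_v f))}.
  exact: Ck_on_continuous (Ck_on_derive w (Ck_on_derive v fC)) Ux.
have cwv : {for x, continuous ('D_v ('D_w f))}.
  exact: Ck_on_continuous (Ck_on_derive v (Ck_on_derive w fC)) Ux.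
have /cvgrPdist_lt/(_ (e / 2)) := cvw; rewrite divr_gt0// => /(_ isT) nvw.
have /cvgrPdist_lt/(_ (e / 2)) := cwv; rewrite divr_gt0// => /(_ isT) nwv.
(* [xi] and [eta] may differ: one continuity estimate is used at [xi], the other at [eta], each
   costing [e / 2]. *)
pose N0 := [set y | `|'D_w ('D_v f) x - 'D_w ('D_v f) y| < e / 2] `&`
   [set y | `|'D_v ('D_w f) x - 'D_v ('D_w f) y| < e / 2] `&` U.
have nN0 : nbhs x N0.
  by apply: filterI; [exact: (filterI nvw nwv) | exact: open_nbhs_nbhs].
pose N := interior N0.
have NU : N `<=` U by move=> y /interior_subset[].
have Nx : N x by exact: nN0.
have fN := Ck_on_sub NU fC.
have oN : open N by exact: open_interior.
have sd1 := @second_difference f x v w N oN Nx fN.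
have sd2 := @second_difference f x w v N oN Nx fN.
have [h [h0 [[xi Nxi xiE] [eta Neta etaE]]]] :=
  filter_ex (filterI (nbhs_right_gt (0 : R)) (filterI sd1 sd2)).
have E : 'D_w ('D_v f) xi = 'D_v ('D_w f) eta.
  have hvw : x + h *: v + h *: w = x + h *: w + h *: v by exact: addrAC.
  move: xiE etaE; rewrite hvw.
  move: (f (x + h *: w + h *: v)) (f (x + h *: v)) (f (x + h *: w)) (f x)
    ('D_w ('D_v f) xi) ('D_v ('D_w f) eta).
  clear -h0 => a b c d X Y XE YE.
  apply: (@mulfI _ (h ^+ 2)); first by rewrite expf_neq0// gt_eqF.
  by rewrite -XE -YE (addrAC a).
have [[/= xi1 _] _] := interior_subset Nxi.
have [[/= _ eta2] _] := interior_subset Neta.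
move: xi1 eta2; rewrite E.
move: ('D_w ('D_v f) x) ('D_v ('D_w f) x) ('D_v ('D_w f) eta).
clear -e0 => a b c ac bc.
rewrite -(subrKA c) (le_trans (ler_normD _ _))//.
by rewrite (splitr e) lerD// ?ltW// distrC.
Qed.

End symmetry_of_second_derivatives.

(** * A smooth bump function *)

Section flat_function.
Context {R : realType}.
Implicit Types (x v h : R) (n k : nat).

(** For [n = 0] this is the classical function exp(-1/x), extended by 0. The powers of 1/x make the
    family stable under differentiation. *)
Definition flat n x : R := if 0 < x then x^-1 ^+ n * expR (- x^-1) else 0.

Lemma flat_gt0 n x : 0 < x -> 0 < flat n x.
Proof. by move=> x0; rewrite /flat x0 mulr_gt0 ?expR_gt0// exprn_gt0 ?invr_gt0. Qed.

Lemma flat_le0 n x : x <= 0 -> flat n x = 0.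
Proof. by rewrite /flat leNgt => /negbTE ->. Qed.

Lemma flat_ge0 n x : 0 <= flat n x.
Proof. by have [/flat_le0 ->//|/flat_gt0/ltW] := leP x 0. Qed.

(* From [exp y >= y^(n+1)/(n+1)!] at [y = 1/x]. *)
Lemma flat_bound n x : flat n x <= (n.+1)`!%:R * `|x|.
Proof.
have [x0|x0] := leP x 0; first by rewrite flat_le0// mulr_ge0.
rewrite /flat x0 gtr0_norm// expRN.
have y0 : 0 < x^-1 by rewrite invr_gt0.
rewrite ler_pdivrMr ?expR_gt0//.
have yE : x^-1 ^+ n.+1 / (n.+1)`!%:R <= expR x^-1.
  by apply: le_trans (expR_ge1Dxn n (ltW y0)); rewrite lerDr.
move: yE.
rewrite -(ler_pM2l (x := (n.+1)`!%:R * x)); last by rewrite mulr_gt0// ltr0n fact_gt0.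
apply: le_trans; rewrite exprS mulrA -[leLHS]mul1r.
rewrite [leRHS](_ : _ = x^-1 ^+ n) ?mul1r//.
have : (n.+1)`!%:R != 0 :> R by rewrite pnatr_eq0 -lt0n fact_gt0.
by move: (_`!%:R) (_ ^+ n) => F Y F0; field; rewrite F0 gt_eqF.
Qed.

Lemma flat_div n h : h^-1 * flat n h = flat n.+1 h.
Proof.
rewrite /flat; case: ifP => h0; last by rewrite mulr0.
by rewrite mulrA -exprS.
Qed.

Lemma flat_cvg0 n : flat n x @[x --> 0] --> 0.
Proof.
apply/cvgrPdist_lt => e e0; near=> x.
rewrite sub0r normrN ger0_norm ?flat_ge0//.
apply: le_lt_trans (flat_bound n x) _.
rewrite mulrC -ltr_pdivlMr ?ltr0n ?fact_gt0//.
near: x.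
have := @nbhs0_lt R R^o (e / (n.+1)`!%:R).
apply; by rewrite divr_gt0// ltr0n fact_gt0.
Unshelve. all: by end_near. Qed.

Lemma is_derive_flat n x :
  is_derive x 1 (flat n) (flat n.+2 x - n%:R * flat n.+1 x).
Proof.
have [x0|x0|->] := ltgtP x 0.
- rewrite !flat_le0 ?ltW// mulr0 subr0.
  apply: (@near_eq_is_derive _ _ _ (cst 0)).
  have : \forall y \near x, y < 0 by apply: open_nbhs_nbhs; split=> //; exact: open_lt.
  by apply: filterS => y y0; rewrite flat_le0// ltW.
- apply: (@near_eq_is_derive _ _ _ (fun y : R => y^-1 ^+ n * expR (- y^-1))).
    have : \forall y \near x, 0 < y by apply: open_nbhs_nbhs; split=> //; exact: open_gt.
    by apply: filterS => y y0; rewrite /flat y0.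
  have xn0 : x != 0 by rewrite gt_eqF.
  have dV : is_derive x 1 (fun y : R => y^-1) (- x^-1 ^+ 2).
    split; first exact: (@derivableV _ _ id).
    rewrite (@deriveV _ _ id)// derive_id exprVn.
    exact: mulr1.
  have dE : is_derive x 1 (fun y : R => expR (- y^-1))
      (x^-1 ^+ 2 * expR (- x^-1)).
    have dNV : is_derive x 1 (fun y : R => - y^-1) (- - x^-1 ^+ 2) by exact: is_deriveN dV.
    have := @is_derive1_comp _ expR (fun y : R => - y^-1) x _ _ (is_derive_expR (- x^-1)) dNV.
    by rewrite opprK mulrC.
  have dP := is_deriveM (is_deriveX n dV) dE.
  rewrite (_ : (fun y : R => y^-1 ^+ n * expR (- y^-1)) =
      ((fun y : R => y^-1) ^+ n * (fun y : R => expR (- y^-1)))); last first.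
    by apply/funext => y; rewrite fctE exprfctE.
  apply: (is_derive_eq dP).
  rewrite /flat x0 /= /GRing.scale /=.
  move: (expR _) => E; rewrite !fctE.
  move: {dP} n => [|n] /=; rewrite ?exprS; last by rewrite -mulr_natl; ring.
  by rewrite ?expr0; ring.
- rewrite !flat_le0// mulr0 subr0.
  (* At 0 the difference quotient of [flat n] is [flat n.+1], whose limit there is 0. *)
  have E : (fun h : R => h^-1 *: ((flat n \o shift 0) (h *: 1) - flat n 0)) = flat n.+1.
    apply/funext => h /=; have -> : h *: (1 : R) = h by exact: mulr1.
    by rewrite addr0 (flat_le0 _ (lexx 0)) subr0; exact: flat_div.
  have c0 : flat n.+1 x @[x --> 0^'] --> 0.
    move=> A /(flat_cvg0 n.+1) hA; apply: nbhs_dnbhs. exact: hA.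
  split; rewrite /derivable /derive E.
    by apply/cvg_ex; exists 0.
  exact/cvg_lim.
Unshelve. all: by end_near. Qed.

(** The induction on [k] is over all [n] at once, since differentiating [flat n] produces
    [flat n.+1] and [flat n.+2]. *)
Lemma Ck_flat n k : Ck_on k setT (flat n).
Proof.
have fd m x : differentiable (flat m) x.
  by apply/derivable1_diffP; case: (is_derive_flat m x).
elim: k n => [|k IH] n; first by move=> x _; exact: differentiable_continuous.
split=> [x _|v]; first exact: fd.
rewrite (_ : (fun _ => _) = (fun x => v * (flat n.+2 x - n%:R * flat n.+1 x))).
  have oT := @openT R.
  apply: Ck_onM => //; first exact: Ck_on_cst.
  apply: Ck_onB => //; apply: Ck_onM => //; exact: Ck_on_cst.
apply/funext => x.
have [_ <-] := is_derive_flat n x.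
rewrite !deriveE; [|exact: fd..].
by rewrite -[X in 'd _ _ X = _]mulr1 [LHS]linearZ.
Qed.

End flat_function.

Section bump_function.
Context {R : realType}.

Definition cutoff (r s : R) : R := flat 0 (r + s) * flat 0 (r - s).

Lemma cutoff_ge0 r s : 0 <= cutoff r s.
Proof. by rewrite mulr_ge0// flat_ge0. Qed.

Lemma cutoff_gt0 r s : `|s| < r -> 0 < cutoff r s.
Proof.
by rewrite ltr_norml => /andP[rs sr]; rewrite mulr_gt0// flat_gt0// ?subr_gt0// -ltrBlDl sub0r.
Qed.

Lemma cutoff_eq0 r s : r <= `|s| -> cutoff r s = 0.
Proof.
rewrite /cutoff ler_normr => /orP[rs|rs].
  by rewrite [X in _ * X]flat_le0 ?mulr0// subr_le0.
by rewrite flat_le0 ?mul0r// -lerBrDr sub0r.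
Qed.

Lemma Ck_cutoff r k : Ck_on k setT (cutoff r).
Proof.
have oT := @openT R.
have Cid : Ck_on k setT (fun s : R => s).
  by apply: (@Ck_on_linear _ _ _ k setT (idfun : {linear R -> R})) => x; exact: cvg_id.
apply: Ck_onM => //.
  apply: (@Ck_on_comp _ _ k setT setT) => //; last exact: Ck_flat.
  by apply: Ck_onD => //; exact: Ck_on_cst.
apply: (@Ck_on_comp _ _ k setT setT) => //; last exact: Ck_flat.
by apply: Ck_onB => //; exact: Ck_on_cst.
Qed.

(** The norm on [space_time R] is the maximum norm, so its balls are cubes, and a product of
    one-variable cutoffs is positive exactly on the open ball without the norm entering the
    formula. *)
Definition smooth_bump (p0 : space_time R) (r : R) (p : space_time R) : R :=
  cutoff r (p.1 - p0.1) * \prod_(j < 3) cutoff r (p.2 0 j - p0.2 0 j).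

Lemma smooth_bump_ge0 p0 r p : 0 <= smooth_bump p0 r p.
Proof. by rewrite mulr_ge0 ?cutoff_ge0// prodr_ge0// => j _; exact: cutoff_ge0. Qed.

Lemma smooth_bump_gt0 p0 r p : `|p - p0| < r -> 0 < smooth_bump p0 r p.
Proof.
rewrite prod_normE /= gt_max => /andP[p1 p2].
rewrite mulr_gt0 ?cutoff_gt0// prodr_gt0// => j _; rewrite cutoff_gt0//.
apply: le_lt_trans p2; rewrite [leRHS]/Num.Def.normr /= mx_normrE.
by have := le_bigmax 0 (fun ij : 'I_1 * 'I_3 => `|(p.2 - p0.2) ij.1 ij.2|) (0, j); rewrite /= !mxE.
Qed.

Lemma smooth_bump_eq0 p0 r p : 0 < r -> r <= `|p - p0| -> smooth_bump p0 r p = 0.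
Proof.
move=> r0; rewrite prod_normE /= le_max /smooth_bump => /orP[p1|p2].
  by rewrite cutoff_eq0 ?mul0r.
have [j rj] : exists j, r <= `|p.2 0 j - p0.2 0 j|.
  apply: contrapT => /forallNP nj; move: p2; apply/negP; rewrite -ltNge.
  rewrite [ltLHS]/Num.Def.normr /= mx_normrE; apply: bigmax_lt => // -[i j] _ /=.
  by rewrite ltNge; apply/negP; rewrite ord1 !mxE; exact: nj.
by rewrite (bigD1 j)//= (cutoff_eq0 rj) mul0r mulr0.
Qed.

Lemma Ck_smooth_bump p0 r k : Ck_on k setT (smooth_bump p0 r).
Proof.
have oT : open [set: space_time R] by exact: openT.
have C1 : Ck_on k setT (fst : space_time R -> R).
  by apply: (@Ck_on_linear R _ _ k setT (fst : {linear (space_time R) -> R})) => x; exact: cvg_fst.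
have C2 : Ck_on k setT (snd : space_time R -> 'rV[R]_3).
  by apply: (@Ck_on_linear R _ _ k setT (snd : {linear (space_time R) -> 'rV[R]_3})) => x; exact: cvg_snd.
have C c (f : space_time R -> R) : Ck_on k setT f ->
    Ck_on k setT (fun p => cutoff r (f p - c)).
  move=> fC; apply: (@Ck_on_comp R _ k setT setT (fun p => f p - c)) => //; last exact: Ck_cutoff.
  by apply: Ck_onB => //; exact: Ck_on_cst.
rewrite /smooth_bump; under eq_fun do rewrite !big_ord_recl big_ord0 mulr1.
have Cj j := C (p0.2 0 j) (fun p => p.2 0 j) (Ck_on_coord j oT C2).
exact: (Ck_onM oT (C _ _ C1) (Ck_onM oT (Cj _) (Ck_onM oT (Cj _) (Cj _)))).
Qed.

End bump_function.

(** * Integration in coordinates *)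

Section continuous_measurable.
Context {R : realType}.

(* [nb] stands for [nbhs]: an abstract [measurableType] carries no topology. *)
Definition measurable_base d (T : measurableType d) (nb : T -> set_system T) :=
  exists (I : countType) (b : I -> set T), (forall i, measurable (b i)) /\
    forall x U, nb x U -> exists2 i, b i x & b i `<=` U.

Lemma measurable_base_R :
  @measurable_base _ (measurableTypeR R) (fun x => nbhs (x : R)).
Proof.
exists (rat * rat)%type.
exists (fun ab => [set x : R | ratr ab.1 < x < ratr ab.2]).
split=> [[a b]|x U] /=.
  have -> : [set x : R | ratr a < x < ratr b] = [set` `](ratr a), (ratr b)[].
    by apply/seteqP; split => x; rewrite /= in_itv.
  exact: measurable_itv.
move=> /nbhs_ballP[e /= e0 eU].
have [a /[!in_itv]/= /andP[a1 a2]] := @rat_in_itvoo R (x - e) x ltac:(by rewrite ltrBlDr ltrDl).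
have [b /[!in_itv]/= /andP[b1 b2]] := @rat_in_itvoo R x (x + e) ltac:(by rewrite ltrDl).
exists (a, b); first by rewrite /= a2 b1.
move=> y /= /andP[ay yb]; apply: eU; rewrite /ball /= ltr_norml.
by apply/andP; split; lra.
Qed.

Lemma measurable_base_prod d1 d2 (T1 : measurableType d1) (T2 : measurableType d2)
    (nb1 : T1 -> set_system T1) (nb2 : T2 -> set_system T2) :
  measurable_base nb1 -> measurable_base nb2 ->
  @measurable_base _ (T1 * T2)%type (fun x => filter_prod (nb1 x.1) (nb2 x.2)).
Proof.
move=> [I1 [b1 [mb1 hb1]]] [I2 [b2 [mb2 hb2]]].
exists (I1 * I2)%type, (fun i => b1 i.1 `*` b2 i.2); split=> [[i j]|[x y] U /=].
  exact: measurableX.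
move=> [[A B] /= [/hb1[i bx bA] /hb2[j by_ bB]] ABU].
by exists (i, j) => // -[u v] [/= /bA Au /bB Bv]; exact: ABU.
Qed.

Lemma measurable_base_open d (T : measurableType d) (nb : T -> set_system T) U :
  measurable_base nb -> (forall x, U x -> nb x U) -> measurable U.
Proof.
move=> [I [b [mb hb]]] oU.
have -> : U = \bigcup_(i in [set i | b i `<=` U]) b i.
  apply/seteqP; split=> [x Ux|x [i /= biU bix]]; last exact: biU.
  by have [i bix biU] := hb x U (oU x Ux); exists i.
rewrite bigcup_mkcond; apply: countable_bigcupT_measurable => [|i]; first exact: countableP.
by case: ifP.
Qed.

(** Boxes with rational endpoints form a countable base, so every set open in the product topology
    belongs to the product sigma-algebra underlying [integral_over]. *)
Lemma continuous_measurable_fun4 (f : R * (R * (R * R)) -> R) : continuous f ->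
  @measurable_fun _ _ (measurableTypeR R * (measurableTypeR R *
    (measurableTypeR R * measurableTypeR R)))%type (measurableTypeR R) setT f.
Proof.
move=> fc.
have mb := measurable_base_prod measurable_base_R (measurable_base_prod
  measurable_base_R (measurable_base_prod measurable_base_R measurable_base_R)).
apply: (measurability _ (measurable_realfun.RGenOpens.measurableE R)).
move=> _ [_ [a [b ->] <-]]; rewrite setTI.
apply: (measurable_base_open mb) => x Ux.
by apply: fc; apply: open_nbhs_nbhs; split=> //; exact: interval_open.
Qed.

End continuous_measurable.

(** * Fubini for bounded functions supported in a set of finite measure *)

Section tame_functions.
Context {R : realType}.

(** These conditions imply integrability when [K] has finite measure, and they pass to sections, so
    Fubini can be applied repeatedly to nested products. *)
Record tame d (T : measurableType d) (K : set T) (f : T -> R) : Prop := Tame {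
  tame_measurable : measurable_fun setT f;
  tame_bounded : exists M : R, forall x, `|f x| <= M;
  tame_support : forall x, ~ K x -> f x = 0 }.

Lemma integrable_tame d (T : measurableType d)
    (mu : {measure set T -> \bar R}) (K : set T) (f : T -> R) :
  measurable K -> (mu K < +oo)%E -> tame K f ->
  mu.-integrable setT (EFin \o f).
Proof.
move=> mK Kfin [mf [M fM] fK].
have iK : mu.-integrable K (EFin \o f).
  apply: measurable_bounded_integrable => //.
    exact: measurable_funTS.
  exists M; split; first exact: num_real.
  by move=> x Mx y _; apply: le_trans (fM y) (ltW Mx).
move: iK; rewrite (integrable_mkcond _ mK).
rewrite (_ : _ \_ K = EFin \o f)//; apply/funext => x.
by rewrite patchE; case: ifPn => // /negP xK; rewrite /= fK// => /mem_set.
Qed.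

Lemma tame_section d1 d2 (T1 : measurableType d1) (T2 : measurableType d2)
    (K1 : set T1) (K2 : set T2) (f : T1 * T2 -> R) x :
  tame (K1 `*` K2) f -> tame K2 (fun y => f (x, y)).
Proof.
move=> [mf [M fM] fK]; split.
- exact: measurable_fun_pair2.
- by exists M => y; exact: fM.
- by move=> y K2y; apply: fK => -[].
Qed.

Variables (d1 d2 : measure_display) (T1 : measurableType d1)
  (T2 : measurableType d2) (K1 : set T1) (K2 : set T2)
  (m1 : {sigma_finite_measure set T1 -> \bar R})
  (m2 : {sigma_finite_measure set T2 -> \bar R}) (f : T1 * T2 -> R).
Hypotheses (mK1 : measurable K1) (mK2 : measurable K2)
  (fK1 : (m1 K1 < +oo)%E) (fK2 : (m2 K2 < +oo)%E) (tf : tame (K1 `*` K2) f).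

Lemma product_box_lty : ((m1 \x m2)%E (K1 `*` K2) < +oo)%E.
Proof. by rewrite product_measure1E// lte_mul_pinfty// ge0_fin_numE. Qed.

Lemma integrable_tame_prod : (m1 \x m2)%E.-integrable setT (EFin \o f).
Proof.
apply: integrable_tame tf; [exact: measurableX | exact: product_box_lty].
Qed.

Lemma integral_prod_eq0_fst :
  (forall y, (\int[m1]_x (f (x, y))%:E = 0)%E) ->
  (\int[m1 \x m2]_z (f z)%:E = 0)%E.
Proof.
move=> f0; rewrite -(integral21_prod_meas1 integrable_tame_prod).
by apply: integral0_eq => y _; exact: f0.
Qed.

Lemma integral_prod_eq0_snd :
  (forall x, (\int[m2]_y (f (x, y))%:E = 0)%E) ->
  (\int[m1 \x m2]_z (f z)%:E = 0)%E.
Proof.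
move=> f0; rewrite -(integral12_prod_meas1 integrable_tame_prod).
by apply: integral0_eq => y _; exact: f0.
Qed.

End tame_functions.

Section sigma_finite_product.
Context {R : realType} d1 d2 (T1 : measurableType d1) (T2 : measurableType d2)
  (m1 : {sigma_finite_measure set T1 -> \bar R})
  (m2 : {sigma_finite_measure set T2 -> \bar R}).

Lemma sigma_finite_product : sigma_finite setT (m1 \x m2)%E.
Proof.
have /sigma_finiteP[A [AT ndA Aoo]] := sigma_finiteT m1.
have /sigma_finiteP[B [BT ndB Boo]] := sigma_finiteT m2.
exists (fun n => A n `*` B n) => [|k].
  apply/seteqP; split=> // -[x y] _.
  have : [set: T1] x by []. rewrite AT => -[i _ Ax].
  have : [set: T2] y by []. rewrite BT => -[j _ By].
  (* Both exhausting sequences are nondecreasing, so one index serves both coordinates. *)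
  exists (maxn i j) => //; split.
  - by move: x Ax; exact/subsetPset/ndA/leq_maxl.
  - by move: y By; exact/subsetPset/ndB/leq_maxr.
have [mA Alty] := Aoo k; have [mB Blty] := Boo k.
by split; [exact: measurableX | exact: product_box_lty].
Qed.

(* The library's own instance is shadowed by the one on subprobabilities. *)
Definition product_sigma_finite_measure :
    {sigma_finite_measure set (T1 * T2)%type -> \bar R} :=
  HB.pack (m1 \x m2)%E
    (Measure_isSigmaFinite.Build _ _ _ (m1 \x m2)%E sigma_finite_product).

End sigma_finite_product.

Section one_dimensional.
Context {R : realType}.

Lemma integral_derivative_eq0 (f F : R -> R) (a b : R) : a < b ->
  continuous f -> (forall x : R, is_derive x 1 F (f x)) ->
  F a = 0 -> F b = 0 -> (forall x, ~ `[a, b]%classic x -> f x = 0) ->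
  (\int[@lebesgue_measure R]_x (f x)%:E = 0)%E.
Proof.
move=> ab fc Fd Fa Fb f0.
have -> : (\int[@lebesgue_measure R]_x (f x)%:E =
  \int[@lebesgue_measure R]_(x in `[a, b]) (f x)%:E)%E.
  rewrite [RHS]integral_mkcond; apply: eq_integral => x _.
  by rewrite patchE; case: ifPn => // /negP xK; rewrite f0// => /mem_set.
have Fc : continuous F.
  by move=> x; apply/differentiable_continuous/derivable1_diffP; case: (Fd x).
rewrite (@continuous_FTC2 R f F)//.
- by rewrite Fa Fb -EFinB subrr.
- exact: continuous_subspaceT.
- split.
  + by move=> x _; case: (Fd x).
  + exact/cvg_at_right_filter/Fc.
  + exact/cvg_at_left_filter/Fc.
- by move=> x _; rewrite derive1E; case: (Fd x).
Qed.

End one_dimensional.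

(** * Derivatives of functions supported in a cube have integral zero *)

Section integration_in_coordinates.
Context {R : realType}.
Implicit Types (p : space_time R) (f G : space_time R -> R).

Local Notation RM := (measurableTypeR R).

(** The measure of [integral_over], rebuilt with sigma-finite factors so that Fubini applies at each
    level; [lambda4] is never itself a factor and is kept as a plain measure. *)
Definition lambda1 : {sigma_finite_measure set RM -> \bar R} := @lebesgue_measure R.
Definition lambda2 : {sigma_finite_measure set (RM * RM)%type -> \bar R} :=
  product_sigma_finite_measure lambda1 lambda1.
Definition lambda3 : {sigma_finite_measure set (RM * (RM * RM))%type -> \bar R} :=
  product_sigma_finite_measure lambda1 lambda2.
Definition lambda4 : {measure set (RM * (RM * (RM * RM)))%type -> \bar R} :=
  (lambda1 \x lambda3)%E.

Lemma integral_overE (A : set (space_time R)) f : integral_over A f =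
  (\int[lambda4]_(q in (@of_coords R @^-1` A : set (RM * (RM * (RM * RM)))%type)) (f (of_coords q))%:E)%E.
Proof. by []. Qed.

Definition e_t : space_time R := (1, 0).
Definition e_x (j : 'I_3) : space_time R := (0, delta_mx 0 j).

(** Varying one coordinate thus moves the point along a line directed by [e_t] or some [e_x j], the
    form that [integral_line] expects. *)
Lemma of_coordsE t x y z : of_coords (t, (x, (y, z))) =
  t *: e_t + x *: e_x (inord 0) + y *: e_x (inord 1) + z *: e_x (inord 2) :> space_time R.
Proof.
apply/pair_equal_spec; split => /=.
  by rewrite /GRing.scale /= !mulr0 !addr0 mulr1.
apply/rowP => j; rewrite !mxE !eqxx /= mulr0 add0r -!val_eqE /= !inordK//.
by case: j => -[|[|[|//]]] ij /=; rewrite ?mulr1 ?mulr0 ?addr0 ?add0r.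
Qed.

Lemma continuous_of_coords : continuous (@of_coords R).
Proof.
move=> -[t [x [y z]]].
have -> : @of_coords R = (fun q => q.1 *: e_t + q.2.1 *: e_x (inord 0) +
    q.2.2.1 *: e_x (inord 1) + q.2.2.2 *: e_x (inord 2)).
  by apply/funext => -[? [? [? ?]]]; rewrite of_coordsE.
have c2 (q : R * (R * (R * R))) : snd q' @[q' --> q] --> snd q by exact: cvg_snd.
have c22 (q : R * (R * (R * R))) : q'.2.2 @[q' --> q] --> q.2.2.
  by apply: cvg_comp; [exact: c2 | exact: cvg_snd].
have Z (c : R * (R * (R * R)) -> R) (w : space_time R) : 
    c q @[q --> (t, (x, (y, z)))] --> c (t, (x, (y, z))) ->
    c q *: w @[q --> (t, (x, (y, z)))] --> c (t, (x, (y, z))) *: w.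
  by move=> cc; exact: cvgZr_tmp.
apply: cvgD; [apply: cvgD; [apply: cvgD|]|].
- exact/Z/cvg_fst.
- by apply: (Z (fun q => q.2.1)); apply: cvg_comp; [exact: c2 | exact: cvg_fst].
- by apply: (Z (fun q => q.2.2.1)); apply: cvg_comp; [exact: c22 | exact: cvg_fst].
- by apply: (Z (fun q => q.2.2.2)); apply: cvg_comp; [exact: c22 | exact: cvg_snd].
Qed.

Lemma ler_norm_time p : `|p.1| <= `|p|.
Proof. by rewrite prod_normE le_max lexx. Qed.

Lemma ler_norm_space p j : `|p.2 0 j| <= `|p|.
Proof.
rewrite prod_normE le_max; apply/orP; right.
rewrite [leRHS]/Num.Def.normr /= mx_normrE.
exact: (le_bigmax 0 (fun ij : 'I_1 * 'I_3 => `|p.2 ij.1 ij.2|) (0, j)).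
Qed.

Variables (Omega : set (space_time R)) (p0 : space_time R) (r : R).
Hypotheses (cOmega : compact Omega) (r_gt0 : 0 < r)
  (ballOmega : forall p, `|p - p0| <= r -> Omega p).

Definition side (c : R) : set RM := `[c - r, c + r]%classic.
Definition side2 : set (RM * RM)%type := side (p0.2 0 (inord 1)) `*` side (p0.2 0 (inord 2)).
Definition side3 : set (RM * (RM * RM))%type := side (p0.2 0 (inord 0)) `*` side2.
Definition side4 : set (RM * (RM * (RM * RM)))%type := side p0.1 `*` side3.

Lemma sideP c s : `|s - c| <= r -> side c s.
Proof. by rewrite ler_distl /side /= in_itv. Qed.

Lemma of_coords_side4 q : `|of_coords q - p0| <= r -> side4 q.
Proof.
case: q => t [x [y z]] qr.
have st := le_trans (ler_norm_time _) qr.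
have sj j := le_trans (ler_norm_space _ j) qr.
split; first exact/sideP.
split; [|split]; apply/sideP.
- by have := sj (inord 0); rewrite !mxE inordK.
- by have := sj (inord 1); rewrite !mxE inordK.
- by have := sj (inord 2); rewrite !mxE inordK.
Qed.

(** The closed ball lies in the compact set [Omega], where the continuous [f] is bounded; elsewhere
    [f] is 0. *)
Lemma tame_of_coords f : continuous f -> (forall p, r < `|p - p0| -> f p = 0) ->
  @tame R _ (measurableTypeR R * (measurableTypeR R *
    (measurableTypeR R * measurableTypeR R)))%type side4 (f \o @of_coords R).
Proof.
move=> fc f0; split.
- apply: continuous_measurable_fun4 => q.
  by apply: continuous_comp; [exact: continuous_of_coords | exact: fc].
- have /compact_bounded[M [_ fM]] : compact (f @` Omega).
    by apply: continuous_compact => //; exact: continuous_subspaceT.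
  (* Only numbers strictly above [M] are known to be bounds, hence [M + 1]; the maximum with 0
     covers the points where [f] vanishes. *)
  exists (Num.max 0 (M + 1)) => q /=.
  have [qr|/f0 ->] := leP `|of_coords q - p0| r; last by rewrite normr0 le_max lexx.
  rewrite le_max; apply/orP; right; apply: (fM (M + 1)); first by rewrite ltrDl.
  by exists (of_coords q) => //; exact: ballOmega.
- move=> q; apply: contra_notP => /eqP fq; apply: of_coords_side4.
  by rewrite leNgt; apply/negP => /f0 /eqP; apply/negP.
Qed.

Lemma measurable_side c : @measurable _ (measurableTypeR R) (side c).
Proof. exact: measurable_itv. Qed.

Lemma side_lty c : (lambda1 (side c) < +oo)%E.
Proof. rewrite -[lambda1 _]/(@lebesgue_measure R `[c - r, c + r]%classic) lebesgue_measure_itv /=.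
by case: ifP => // _; rewrite -EFinB ltry. Qed.

Lemma measurable_side2 : @measurable _ (measurableTypeR R * measurableTypeR R)%type side2.
Proof. by apply: measurableX; exact: measurable_side. Qed.

Lemma side2_lty : (lambda2 side2 < +oo)%E.
Proof.
exact: (product_box_lty (measurable_side _) (measurable_side _) (side_lty _) (side_lty _)).
Qed.

Lemma measurable_side3 : @measurable _ (measurableTypeR R *
  (measurableTypeR R * measurableTypeR R))%type side3.
Proof. by apply: measurableX; [exact: measurable_side | exact: measurable_side2]. Qed.

Lemma side3_lty : (lambda3 side3 < +oo)%E.
Proof.
exact: (product_box_lty (measurable_side _) measurable_side2 (side_lty _) side2_lty).
Qed.

Lemma integrable_of_coords f : continuous f -> (forall p, r < `|p - p0| -> f p = 0) ->
  lambda4.-integrable setT (EFin \o (f \o @of_coords R)).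
Proof.
move=> fc f0; apply: (@integrable_tame_prod R _ _ _ _ (side p0.1) side3).
- exact: measurable_side.
- exact: measurable_side3.
- exact: side_lty.
- exact: side3_lty.
- exact: tame_of_coords.
Qed.

(** The strict inequality defines an open region, so [G] vanishes near [p] and not only at [p]. *)
Lemma derive_support G v p : (forall q, r <= `|q - p0| -> G q = 0) ->
  r < `|p - p0| -> 'D_v G p = 0.
Proof.
move=> G0 rp; rewrite -(derive_cst (0 : R) p v); apply: near_eq_derive.
have nc : {for p, continuous (fun q : space_time R => `|q - p0|)}.
  apply: (@continuous_comp _ _ _ (fun q : space_time R => q - p0)
    (fun q : space_time R => `|q|)); last exact: norm_continuous.
  by apply: cvgB; [exact: cvg_id | exact: cvg_cst].
have : \forall q \near p, r < `|q - p0| by exact: (cvgr_gt _ nc).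
by apply: filterS => q /ltW /G0.
Qed.

(** The hypothesis on [c] says that the line is outside the open cube once [s] is at distance at
    least [r] from [c]. So [G] vanishes at both ends of [[c - r, c + r]], and the fundamental
    theorem of calculus gives 0. *)
Lemma integral_line G v (a : space_time R) (c : R) : Ck_on 1 setT G ->
  (forall q, r <= `|q - p0| -> G q = 0) ->
  (forall s : R, `|s - c| <= `|a + s *: v - p0|) ->
  (\int[lambda1]_s ('D_v G (a + s *: v))%:E = 0)%E.
Proof.
move=> GC G0 ac.
have r0 := r_gt0.
apply: (@integral_derivative_eq0 R (fun s => 'D_v G (a + s *: v))
  (fun s => G (a + s *: v)) (c - r) (c + r)).
- by lra.
- move=> s; apply: (@continuous_comp _ _ _ (fun s : R => a + s *: v) ('D_v G)).
    by apply: cvgD; [exact: cvg_cst | exact: scalel_continuous].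
  exact: (Ck_on_continuous (Ck_on_derive v GC)).
- by move=> s; apply: is_derive_line; apply: diff_derivable; exact: (Ck_on_diff GC).
- by apply: G0; apply: le_trans (ac _); rewrite addrC addKr normrN ger0_norm// ltW.
- by apply: G0; apply: le_trans (ac _); rewrite addrC addKr ger0_norm// ltW.
- move=> s cs; apply: derive_support G0 _; apply: lt_le_trans (ac s).
  by rewrite ltNge; apply/negP => /sideP.
Qed.

Lemma integral_derive_t G : Ck_on 1 setT G ->
  (forall q, r <= `|q - p0| -> G q = 0) ->
  (\int[lambda4]_q ('D_e_t G (of_coords q))%:E = 0)%E.
Proof.
move=> GC G0.
have tG := tame_of_coords (fun p => Ck_on_continuous (Ck_on_derive e_t GC) I)
  (fun p => @derive_support G e_t p G0).
apply: (integral_prod_eq0_fst (measurable_side _) measurable_side3 (side_lty _) side3_lty tG).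
move=> [x [y z]] /=.
have E t : of_coords (t, (x, (y, z))) = of_coords (0, (x, (y, z))) + t *: e_t.
  by rewrite !of_coordsE scale0r add0r [RHS]addrC !addrA.
under eq_integral do rewrite E.
apply: (integral_line (c := p0.1)) => // s; rewrite -E.
by apply: le_trans (ler_norm_time _).
Qed.

(** Fubini makes the integral over the [j]-th coordinate innermost, at whatever depth of the nested
    product it sits; there [integral_line] applies. *)
Lemma integral_derive_x G j : Ck_on 1 setT G ->
  (forall q, r <= `|q - p0| -> G q = 0) ->
  (\int[lambda4]_q ('D_(e_x j) G (of_coords q))%:E = 0)%E.
Proof.
move=> GC G0.
have tG := tame_of_coords (fun p => Ck_on_continuous (Ck_on_derive (e_x j) GC) I)
  (fun p => @derive_support G (e_x j) p G0).
apply: (integral_prod_eq0_snd (measurable_side _) measurable_side3 (side_lty _) side3_lty tG).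
move=> t.
have tG3 := tame_section t tG.
have ms := measurable_side.
have ls := side_lty.
(* As [a] has [j]-th coordinate 0, the parameter [s] is the [j]-th coordinate of the moving
   point. *)
have line (a : space_time R) : a.2 0 j = 0 -> (\int[lambda1]_s ('D_(e_x j) G (a + s *: e_x j))%:E = 0)%E.
  move=> aj; apply: (integral_line (c := p0.2 0 j)) => // s.
  apply: le_trans (ler_norm_space _ j).
  by rewrite !mxE aj !eqxx mulr1 add0r.
have [j0|[j1|j2]] : j = inord 0 \/ j = inord 1 \/ j = inord 2.
- by case: j {GC G0 tG tG3 line} => -[|[|[|//]]] ij; [left|right;left|right;right];
    apply/val_inj; rewrite /= inordK.
- apply: (integral_prod_eq0_fst (ms _) measurable_side2 (ls _) side2_lty tG3).
  move=> [y z] /=.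
  have E x : of_coords (t, (x, (y, z))) = of_coords (t, (0, (y, z))) + x *: e_x j.
    by rewrite !of_coordsE scale0r addr0 j0 [RHS]addrAC; congr (_ + _); rewrite addrAC.
  under eq_integral do rewrite E.
  by apply: line; rewrite j0 !mxE inordK.
- apply: (integral_prod_eq0_snd (ms _) measurable_side2 (ls _) side2_lty tG3).
  move=> x; have tG2 := tame_section x tG3.
  apply: (integral_prod_eq0_fst (ms _) (ms _) (ls _) (ls _) tG2) => z /=.
  have E y : of_coords (t, (x, (y, z))) = of_coords (t, (x, (0, z))) + y *: e_x j.
    by rewrite !of_coordsE scale0r addr0 j1 addrAC.
  under eq_integral do rewrite E.
  by apply: line; rewrite j1 !mxE inordK.
- apply: (integral_prod_eq0_snd (ms _) measurable_side2 (ls _) side2_lty tG3).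
  move=> x; have tG2 := tame_section x tG3.
  apply: (integral_prod_eq0_snd (ms _) (ms _) (ls _) (ls _) tG2) => y /=.
  have E z : of_coords (t, (x, (y, z))) = of_coords (t, (x, (y, 0))) + z *: e_x j.
    by rewrite !of_coordsE scale0r addr0 j2.
  under eq_integral do rewrite E.
  by apply: line; rewrite j2 !mxE inordK.
Qed.

End integration_in_coordinates.

(** * The fundamental lemma of the calculus of variations *)

Section fundamental_lemma.
Context {R : realType}.
Implicit Types (p q : space_time R) (f G E : space_time R -> R) (r : R).

Local Notation RM := (measurableTypeR R).
Local Notation RM4 := (RM * (RM * (RM * RM)))%type.

Lemma side4_norm p0 r (q : R * (R * (R * R))) : 0 <= r -> side4 p0 r q -> `|of_coords q - p0| <= r.
Proof.
move=> r0; case: q => t [x [y z]] [/= st [sx [sy sz]]].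
have S c s : side r c s -> `|s - c| <= r by rewrite ler_distl /side /= in_itv.
rewrite prod_normE ge_max /= (S _ _ st) /=.
rewrite [leLHS]/Num.Def.normr /= mx_normrE; apply: bigmax_le => // -[i j] _ /=.
rewrite ord1 !mxE.
have [->|[->|->]] : j = inord 0 \/ j = inord 1 \/ j = inord 2.
- by case: j => -[|[|[|//]]] ij; [left|right;left|right;right];
    apply/val_inj; rewrite /= inordK.
- by rewrite inordK//=; exact: S.
- by rewrite inordK//=; exact: S.
- by rewrite inordK//=; exact: S.
Qed.

Lemma measurable_side4 p0 r : @measurable _ RM4 (side4 p0 r).
Proof. by apply: measurableX; [exact: measurable_side | exact: measurable_side3]. Qed.

Lemma side_gt0 r c : 0 < r -> (0 < @lambda1 R (side r c))%E.
Proof.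
move=> r0.
rewrite -[lambda1 _]/(@lebesgue_measure R `[c - r, c + r]%classic).
rewrite lebesgue_measure_itv /= ifT -?EFinB lte_fin; lra.
Qed.

Lemma side4_gt0 p0 r : 0 < r -> (0 < @lambda4 R (side4 p0 r))%E.
Proof.
move=> r0.
have ms := @measurable_side R r.
rewrite -[lambda4 _]/((lambda1 \x lambda3)%E (side4 p0 r)).
rewrite product_measure1E//; last exact: measurable_side3.
rewrite -[lambda3 _]/((lambda1 \x lambda2)%E (side3 p0 r)).
rewrite product_measure1E//; last exact: measurable_side2.
rewrite -[lambda2 _]/((lambda1 \x lambda1)%E (side2 p0 r)).
rewrite product_measure1E//.
by rewrite !mule_gt0// side_gt0.
Qed.

(** By continuity [f] exceeds [f p0 / 2] on a small cube around [p0], and that cube has positive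
    measure. *)
Lemma integral_gt0 (p0 : space_time R) f : continuous f ->
  (forall p, 0 <= f p) -> 0 < f p0 ->
  (0 < \int[@lambda4 R]_q (f (of_coords q))%:E)%E.
Proof.
move=> fc f0 fp0.
have mf : @measurable_fun _ _ RM4 RM setT (f \o @of_coords R).
  apply: continuous_measurable_fun4 => q.
  by apply: continuous_comp; [exact: continuous_of_coords | exact: fc].
have : \forall p \near p0, f p0 / 2 < f p.
  by apply: (cvgr_gt _ (fc p0)); lra.
move=> /nbhs_ballP[e /= e0 ef].
(* Halving fits the closed cube [side4] into the open ball of radius [e]. *)
have e20 : 0 < e / 2 by lra.
have S0 := side4_gt0 p0 e20.
have mS := measurable_side4 p0 (e / 2).
have cS : (0 < (f p0 / 2)%:E * @lambda4 R (side4 p0 (e / 2)))%E.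
  by rewrite mule_gt0// lte_fin; lra.
apply: (lt_le_trans cS).
rewrite -integral_cst//.
apply: (@le_trans _ _ (\int[@lambda4 R]_(q in side4 p0 (e / 2)) (f (of_coords q))%:E)%E).
  apply: ge0_le_integral => //.
  - by move=> q _; rewrite lee_fin; lra.
  - by apply/measurable_realfun.measurable_EFinP; exact: measurable_funTS.
  - move=> q Sq; rewrite lee_fin ltW//; apply: ef.
    rewrite -ball_normE /= distrC; apply: le_lt_trans (side4_norm (ltW e20) Sq) _; lra.
apply: ge0_subset_integral => //.
- exact/measurable_realfun.measurable_EFinP.
- by move=> q _; rewrite lee_fin.
Qed.

Lemma open_norm_gt p0 r : open [set p | r < `|p - p0|].
Proof.
have nc : continuous (fun q => `|q - p0|).
  move=> p; apply: (@continuous_comp _ _ _ (fun q : space_time R => q - p0)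
    (fun q : space_time R => `|q|)); last exact: norm_continuous.
  by apply: cvgB; [exact: cvg_id | exact: cvg_cst].
by apply: (open_comp (f := fun q => `|q - p0|) (D := [set x | r < x])) => //; exact: open_gt.
Qed.

(** [V] and the open complement of the closed ball cover the space, and [f] is 0 on the latter. This
    makes a field defined well only on [V], times a bump, smooth everywhere. *)
Lemma Ck_on_support k (V : set (space_time R)) p0 r f :
  (forall p, `|p - p0| <= r -> V p) -> (forall p, r < `|p - p0| -> f p = 0) ->
  Ck_on k V f -> Ck_on k setT f.
Proof.
move=> rV f0 fC; have oN := @open_norm_gt p0 r.
apply: (@Ck_on_sub _ _ _ _ (V `|` [set p | r < `|p - p0|])).
  by move=> p _; have [/rV|] := leP `|p - p0| r; [left|right].
apply: Ck_on_setU => //; apply: Ck_on_ext (Ck_on_cst _ _ 0) => //.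
by move=> p /set_mem /= /f0.
Qed.

(** Keeping the integrand as a divergence minus [phi E] reduces integration by parts to the
    vanishing integrals [integral_derive_t] and [integral_derive_x], and leaves the integral of
    [phi E] equal to 0. *)
Lemma conservation_form (Omega V : set (space_time R)) E
    (A0 : space_time R -> R) (A : 'I_3 -> space_time R -> R) :
  regular_domain Omega -> open V -> Omega `<=` V ->
  Ck_on 0 V E -> Ck_on 1 V A0 -> (forall j, Ck_on 1 V (A j)) ->
  (forall phi, (forall k, Ck_on k setT phi) -> test_function Omega phi ->
    integral_over Omega (fun p => dt (fun q => A0 q * phi q) p +
      \sum_(j < 3) dx j (fun q => A j q * phi q) p - phi p * E p) = 0%E) ->
  forall p, Omega p -> E p = 0.
Proof.
move=> [cO clO] oV OV EC A0C AC H.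
have cE p : Omega p -> {for p, continuous E}.
  by move=> /OV; exact: Ck_on_continuous EC.
(* If [E p] were nonzero, [E] would be nonzero on a neighbourhood of [p], which meets the
   interior. *)
suff E0 p : interior Omega p -> E p = 0.
  move=> p Op; apply: contrapT => /eqP Ep.
  have := cE p Op => /cvgr_neq0 /(_ Ep) nE.
  have : closure (interior Omega) p by rewrite clO.
  by move=> /(_ _ nE) [q [/E0 -> /eqP]].
move=> Oip; apply: contrapT => /eqP Ep.
have Op := interior_subset Oip.
(* Multiplying [E] by the constant [E p] avoids a case distinction on its sign. *)
have Ep2 : 0 < E p * E p by rewrite -expr2 exprn_even_gt0.
have : \forall q \near p, 0 < E p * E q.
  have : {for p, continuous (fun q => E p * E q)}.
    by apply: continuousM; [exact: cst_continuous | exact: cE].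
  by move=> /cvgr_gt; exact.
have nO : nbhs p (interior Omega) by apply: open_nbhs_nbhs; split=> //; exact: open_interior.
move=> /(filterI nO)/nbhs_ballP[e /= e0 eE].
pose r := e / 2.
have r0 : 0 < r by rewrite /r; lra.
have rE q : `|q - p| <= r -> interior Omega q /\ 0 < E p * E q.
  move=> qr; apply: eE; rewrite -ball_normE /= distrC; apply: le_lt_trans qr _.
  by rewrite /r; lra.
pose phi := smooth_bump p r.
have phi0 q : r <= `|q - p| -> phi q = 0 by exact: smooth_bump_eq0.
have rO q : `|q - p| <= r -> Omega q by move=> /rE[/interior_subset].
have rV q : `|q - p| <= r -> V q by move=> /rO/OV.
have phiC k : Ck_on k setT phi by exact: Ck_smooth_bump.
have phiT : test_function Omega phi.
  split; first by exists setT; split=> //; exact: openT.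
  move=> q [_ nq]; apply: phi0; rewrite leNgt; apply/negP => /ltW /rE[].
  by move=> /nq.
have prodC k (f : space_time R -> R) : Ck_on k V f -> Ck_on k setT (fun q => f q * phi q).
  move=> fC; apply: (Ck_on_support rV).
    by move=> q /ltW /phi0 ->; rewrite mulr0.
  by apply: Ck_onM => //; exact: Ck_on_sub (phiC k).
have prod0 (f : space_time R -> R) q : r <= `|q - p| -> f q * phi q = 0.
  by move=> /phi0 ->; rewrite mulr0.
have := H phi phiC phiT; rewrite integral_overE.
pose h q := dt (fun q => A0 q * phi q) q +
      \sum_(j < 3) dx j (fun q => A j q * phi q) q - phi q * E q.
(* This lets the integral over [Omega] be replaced by one over the whole space. *)
have h0 q : ~ Omega q -> h q = 0.
  move=> nOq; have rq : r < `|q - p| by rewrite ltNge; apply/negP => /rO.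
  rewrite /h /dt (derive_support _ (prod0 A0) rq) phi0 ?ltW// mul0r subr0 add0r.
  by rewrite big1// => j _; rewrite /dx (derive_support _ (prod0 (A j)) rq).
rewrite integral_mkcond.
have -> : ((fun q : RM4 => (h (of_coords q))%:E) \_ (@of_coords R @^-1` Omega))
   = (fun q : RM4 => (h (of_coords q))%:E).
  apply/funext => q; rewrite patchE; case: ifPn => // /negP qO; rewrite h0// => Oq.
  by apply: qO; exact/mem_set.
move=> HO.
have supp (f : space_time R -> R) : (forall q, r <= `|q - p| -> f q = 0) ->
    forall q, r < `|q - p| -> f q = 0.
  by move=> f0 q /ltW /f0.
have contPE : continuous (fun q => phi q * E q).
  move=> q; apply: (@Ck_on_continuous _ _ _ 0 setT) => //.
  rewrite (_ : (fun _ => _) = (fun q => E q * phi q)); first exact: prodC.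
  by apply/funext => ?; rewrite mulrC.
have intE : (@lambda4 R).-integrable setT
    (EFin \o ((fun q => phi q * E q) \o @of_coords R)).
  apply: (integrable_of_coords cO rO).
    exact: contPE.
  by apply: supp => q /phi0 ->; rewrite mul0r.
have intD (f : space_time R -> R) v : Ck_on 1 V f -> (@lambda4 R).-integrable setT
    (EFin \o ('D_v (fun q => f q * phi q) \o @of_coords R)).
  move=> fC; apply: (integrable_of_coords cO rO).
    by move=> q; exact: (Ck_on_continuous (Ck_on_derive v (prodC _ _ fC))).
  by move=> q; exact: derive_support (prod0 f).
have iD (f : space_time R -> R) v : Ck_on 1 V f -> (exists j, v = e_x j) \/ v = e_t ->
    (\int[@lambda4 R]_z ('D_v (fun q => f q * phi q) (of_coords z))%:E = 0)%E.
  move=> fC [[j ->]|->].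
    exact: (integral_derive_x cO r0 rO j (prodC _ _ fC) (prod0 f)).
  exact: (integral_derive_t cO r0 rO (prodC _ _ fC) (prod0 f)).
have intS : (@lambda4 R).-integrable setT (fun z => \sum_(j < 3)
    (dx j (fun q => A j q * phi q) (of_coords z))%:E)%E.
  by apply: integrable_sum => // j _; exact: (intD _ (e_x j) (AC j)).
have int0 : (\int[@lambda4 R]_z (phi (of_coords z) * E (of_coords z))%:E = 0)%E.
  move: HO; under eq_integral do rewrite EFinB EFinD -sumEFin.
  have intT := intD _ e_t A0C.
  rewrite integralB//; last exact: integrableD.
  rewrite integralD// integral_sum//; last first.
    by move=> j; exact: (intD _ (e_x j) (AC j)).
  rewrite (iD _ _ A0C); last by right.
  rewrite big1 ?add0e ?sub0e; last by move=> j _; apply: iD (AC j) _; left; exists j.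
  by move=> /eqP; rewrite oppe_eq0 => /eqP.
have pos : (0 < \int[@lambda4 R]_z (E p * (phi (of_coords z) * E (of_coords z)))%:E)%E.
  apply: (@integral_gt0 p (fun q => E p * (phi q * E q))).
  - move=> q; apply: cvgM; first exact: cvg_cst.
    exact: contPE.
  - move=> q; have [qr|qr] := leP r `|q - p|; first by rewrite phi0// mul0r mulr0.
    by rewrite mulrCA mulr_ge0 ?smooth_bump_ge0// ltW//; case: (rE q (ltW qr)).
  - by rewrite mulrCA mulr_gt0// smooth_bump_gt0// subrr normr0.
move: pos; under eq_integral do rewrite EFinM.
by rewrite integralZl// int0 mule0 ltxx.
Qed.

End fundamental_lemma.

(** * Variations of the action *)

Section independent_variables.
Context {R : realType}.

Lemma nvarP (P : 'I_nvar -> Prop) :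
  P i_rho -> P i_s -> P i_s1 -> P i_s2 -> P i_ai -> P i_y -> P i_alpha ->
  P i_Dalpha -> P i_Dai -> (forall j, P (i_u j)) -> forall b, P b.
Proof.
move=> P0 P1 P2 P3 P4 P5 P6 P7 P8 Pu b.
case: (split_ordP b) => [k ->|j ->]; last exact: Pu.
case: k => -[|[|[|[|[|[|[|[|[|//]]]]]]]]] ik.
- by rewrite (_ : lshift 3 _ = i_rho)//; exact: val_inj.
- by rewrite (_ : lshift 3 _ = i_s)//; exact: val_inj.
- by rewrite (_ : lshift 3 _ = i_s1)//; exact: val_inj.
- by rewrite (_ : lshift 3 _ = i_s2)//; exact: val_inj.
- by rewrite (_ : lshift 3 _ = i_ai)//; exact: val_inj.
- by rewrite (_ : lshift 3 _ = i_y)//; exact: val_inj.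
- by rewrite (_ : lshift 3 _ = i_alpha)//; exact: val_inj.
- by rewrite (_ : lshift 3 _ = i_Dalpha)//; exact: val_inj.
- by rewrite (_ : lshift 3 _ = i_Dai)//; exact: val_inj.
Qed.

Lemma sum_nvar (F : 'I_nvar -> R) : \sum_b F b =
  F i_rho + F i_s + F i_s1 + F i_s2 + F i_ai + F i_y + F i_alpha + F i_Dalpha +
  F i_Dai + \sum_(j < 3) F (i_u j).
Proof.
rewrite big_split_ord /=; congr (_ + _).
rewrite !big_ord_recl big_ord0 addr0 !addrA.
by do ![congr (_ + _)]; congr F; apply/val_inj.
Qed.

Lemma mk_varsE (rho s s1 s2 ai y alpha Dalpha Dai : R) (u : 'rV[R]_3) :
  let B := mk_vars rho s s1 s2 ai y alpha Dalpha Dai u in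
  (B 0 i_rho = rho) * (B 0 i_s = s) * (B 0 i_s1 = s1) * (B 0 i_s2 = s2) *
  (B 0 i_ai = ai) * (B 0 i_y = y) * (B 0 i_alpha = alpha) *
  (B 0 i_Dalpha = Dalpha) * (B 0 i_Dai = Dai) * (forall j, B 0 (i_u j) = u 0 j).
Proof.
do !split; rewrite ?/mk_vars ?row_mxEl ?mxE//.
by move=> j; rewrite row_mxEr.
Qed.

(** Here the denominators in [energy] are positive, and so are the first arguments of [e1] and [e2].
    Each condition has the form [0 < _], so openness follows one inequality at a time. *)
Definition physical_vars : set 'rV[R]_nvar := [set B |
  0 < B 0 i_rho /\ 0 < B 0 i_ai /\ 0 < B 0 i_y /\ 0 < 1 - B 0 i_y /\
  0 < B 0 i_alpha /\ 0 < 1 - B 0 i_alpha].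

Lemma open_setI_gt0 (V : normedModType R) (U : set V) (f : V -> R) : open U ->
  Ck_on 0 U f -> open [set x | U x /\ 0 < f x].
Proof.
move=> oU fC; rewrite openE => x [Ux fx].
by apply: filterI; [exact: open_nbhs_nbhs | exact: (cvgr_gt _ (fC x Ux))].
Qed.

Lemma open_physical_vars : open physical_vars.
Proof.
have oT := @openT 'rV[R]_nvar.
have c b : Ck_on 0 setT (fun B : 'rV[R]_nvar => B 0 b).
  by move=> x _; exact: coord_continuous.
have c1 b : Ck_on 0 setT (fun B : 'rV[R]_nvar => 1 - B 0 b).
  by apply: Ck_onB => //; exact: Ck_on_cst.
have o (f : 'rV[R]_nvar -> R) : Ck_on 0 setT f -> open [set B | 0 < f B].
  move=> fC; have := open_setI_gt0 oT fC.
  by rewrite (_ : [set x | _] = [set B | 0 < f B])//; apply/seteqP; split=> [x []|x].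
by do 5![apply: openI; first exact: o]; exact: o.
Qed.

Lemma Ck_lagrangian (m nu : R) (e1 e2 : R -> R -> R) (ei : R -> R) k :
  smooth_on [set v : R * R | 0 < v.1] (fun v => e1 v.1 v.2) ->
  smooth_on [set v : R * R | 0 < v.1] (fun v => e2 v.1 v.2) ->
  smooth_on [set: R] ei ->
  Ck_on k physical_vars (lagrangian m nu e1 e2 ei).
Proof.
move=> [U1 [_ U1p e1C]] [U2 [_ U2p e2C]] [U3 [_ U3p eiC]].
have oW := open_physical_vars.
have c b : Ck_on k physical_vars (fun B : 'rV[R]_nvar => B 0 b).
  apply: (@Ck_on_coord R _ k _ _ id) => //.
  by apply: (@Ck_on_linear R _ _ k _ (idfun : {linear _ -> _})) => x; exact: cvg_id.
have cst (a : R) : Ck_on k physical_vars (fun=> a) by exact: Ck_on_cst.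
have c1 b : Ck_on k physical_vars (fun B : 'rV[R]_nvar => 1 - B 0 b).
  exact: Ck_onB.
have M (f g : 'rV[R]_nvar -> R) : Ck_on k physical_vars f -> Ck_on k physical_vars g ->
    Ck_on k physical_vars (fun B => f B * g B) by exact: Ck_onM.
have D (f g : 'rV[R]_nvar -> R) : Ck_on k physical_vars f -> Ck_on k physical_vars g ->
    Ck_on k physical_vars (fun B => f B + g B : R) by exact: Ck_onD.
have S (f g : 'rV[R]_nvar -> R) : Ck_on k physical_vars f -> Ck_on k physical_vars g ->
    Ck_on k physical_vars (fun B => f B - g B : R) by exact: Ck_onB.
have X (f : 'rV[R]_nvar -> R) n : Ck_on k physical_vars f ->
    Ck_on k physical_vars (fun B => f B ^+ n) by exact: Ck_onX.
have Q (f g : 'rV[R]_nvar -> R) : Ck_on k physical_vars f -> Ck_on k physical_vars g ->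
    (forall B, physical_vars B -> 0 < g B) ->
    Ck_on k physical_vars (fun B => f B / g B).
  move=> fC gC g0; apply: (M _ _) => //; apply: Ck_onV => // B /g0.
  by move=> g0B; rewrite gt_eqF.
(* The absolute values in the kinetic terms are removed before differentiating. *)
have nE (f : 'rV[R]_nvar -> R) : (fun B => `|f B| ^+ 2) = (fun B => f B ^+ 2).
  by apply/funext => B; rewrite real_normK// num_real.
rewrite /lagrangian /energy.
apply: (S _ _); [apply: (D _ _); [apply: (D _ _)|]|].
- apply: (M _ _); first exact: (M _ _).
  by apply: Ck_on_sum => // j; exact: (X _ _).
- by apply: (M _ _) => //; rewrite nE; exact: (X _ _).
- by apply: (M _ _) => //; rewrite nE; exact: (X _ _).
- apply: (M _ _) => //; apply: (D _ _); [apply: (D _ _)|].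
  + apply: (M _ _) => //; apply: (Ck_on_comp_pair (U' := U1)) => //.
      by move=> B [? [? [? [? [? ?]]]]]; apply: U1p; rewrite /= divr_gt0// mulr_gt0.
    apply: (Q _ _) => //; first exact: (M _ _).
    by move=> B [? [? [? [? [? ?]]]]]; rewrite mulr_gt0.
  + apply: (M _ _) => //; apply: (Ck_on_comp_pair (U' := U2)) => //.
      by move=> B [? [? [? [? [? ?]]]]]; apply: U2p; rewrite /= divr_gt0// mulr_gt0.
    apply: (Q _ _) => //; first exact: (M _ _).
    by move=> B [? [? [? [? [? ?]]]]]; rewrite mulr_gt0.
  + apply: (M _ _).
      by apply: (Q _ _) => // B [].
    apply: (@Ck_on_comp R _ k _ U3 _ ei) => //; first by move=> B _; exact: U3p.
    apply: (Q _ _) => //; last by move=> B [_ []].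
    by apply: (M _ _) => //; apply: (S _ _); [apply: (S _ _) => //; exact: (M _ _) | exact: (M _ _)].
Qed.

End independent_variables.

Section derivative_rules.
Context {R : realType} {V : normedModType R}.
Implicit Types (f g : V -> R) (v x : V).

Lemma derive_mul f g v x : differentiable f x -> differentiable g x ->
  'D_v (fun y => f y * g y) x = f x * 'D_v g x + g x * 'D_v f x.
Proof. by move=> df dg; rewrite [LHS]deriveM//; exact: diff_derivable. Qed.

Lemma derive_sub f g v x : differentiable f x -> differentiable g x ->
  'D_v (fun y => f y - g y) x = 'D_v f x - 'D_v g x.
Proof. by move=> df dg; rewrite [LHS]deriveB//; exact: diff_derivable. Qed.

Lemma derive_add f g v x : differentiable f x -> differentiable g x ->
  'D_v (fun y => f y + g y) x = 'D_v f x + 'D_v g x.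
Proof. by move=> df dg; rewrite [LHS]deriveD//; exact: diff_derivable. Qed.

Lemma derive_opp f v x : differentiable f x ->
  'D_v (fun y => - f y) x = - 'D_v f x.
Proof. by move=> df; rewrite [LHS]deriveN//; exact: diff_derivable. Qed.

Lemma derive_scale (W : normedModType R) f (w : W) v x : differentiable f x ->
  'D_v (fun y => f y *: w) x = 'D_v f x *: w.
Proof.
move=> df; rewrite !deriveE//; last exact: differentiableZl.
by rewrite diffZl.
Qed.

Lemma derive_coord n (f : V -> 'rV[R]_n) v x j : differentiable f x ->
  ('D_v f x) 0 j = 'D_v (fun y => f y 0 j) x.
Proof. by move=> df; rewrite derive_mx ?mxE//; exact: diff_derivable. Qed.

Lemma derive_comp_row n (f : V -> 'rV[R]_n) (g : 'rV[R]_n -> R) v x :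
  differentiable f x -> differentiable g (f x) ->
  'D_v (g \o f) x =
  \sum_(b < n) 'D_(delta_mx 0 b) g (f x) * 'D_v (fun y => f y 0 b) x.
Proof.
move=> df dg; rewrite (deriveE _ (differentiable_comp df dg)) (diff_comp df dg) /=.
rewrite -(deriveE _ df) [X in 'd g _ X]row_sum_delta raddf_sum.
apply: eq_bigr => b _.
by rewrite [LHS]linearZ (deriveE _ dg) derive_coord// mulrC.
Qed.

End derivative_rules.

Section variations.
Context {R : realType}.
Implicit Types (p q : space_time R) (f phi : space_time R -> R).

Lemma advect_delta (W : normedModType R) (w : space_time R -> 'rV[R]_3) c i
    (f : space_time R -> W) p :
  w p = c *: delta_mx 0 i -> advect w f p = c *: dx i f p.
Proof.
move=> wp; rewrite /advect wp (bigD1 i)//= !mxE !eqxx mulr1.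
by rewrite big1 ?addr0// => j ji; rewrite !mxE eqxx (negbTE ji) mulr0 scale0r.
Qed.

Lemma advect0 (W : normedModType R) (w : space_time R -> 'rV[R]_3)
    (f : space_time R -> W) p : w p = 0 -> advect w f p = 0.
Proof. by move=> wp; rewrite /advect big1// => j _; rewrite wp mxE scale0r. Qed.

Lemma div_delta f i p : div (fun q => f q *: delta_mx 0 i) p = dx i f p.
Proof.
rewrite /div (bigD1 i)//= [X in _ + X]big1 ?addr0.
  by congr (dx i _ p); apply/funext => q; rewrite !mxE !eqxx mulr1.
move=> j ji; rewrite /dx (_ : (fun _ => _) = cst 0) ?derive_cst//.
by apply/funext => q; rewrite !mxE eqxx (negbTE ji) mulr0.
Qed.

Lemma Dt0 (W : normedModType R) u p : Dt u (fun=> 0 : W) p = 0.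
Proof.
rewrite /Dt /dt derive_cst add0r /advect big1// => j _.
by rewrite /dx derive_cst scaler0.
Qed.

Lemma Dt_mul u f g p : differentiable f p -> differentiable g p ->
  Dt u (fun q => f q * g q) p = f p * Dt u g p + g p * Dt u f p.
Proof.
move=> df dg; rewrite /Dt /dt derive_mul// /advect.
under eq_bigr => j _ do rewrite /dx derive_mul// scalerDr.
rewrite big_split /= !mulrDr !mulr_sumr.
rewrite [in RHS]addrACA; congr (_ + (_ + _)); apply: eq_bigr => j _.
  by rewrite /GRing.scale /= mulrCA.
by rewrite /GRing.scale /= mulrCA.
Qed.

Lemma Dt_opp u f p : differentiable f p -> Dt u (fun q => - f q) p = - Dt u f p.
Proof.
move=> df; rewrite /Dt /dt derive_opp// opprD; congr (_ + _).
rewrite /advect -sumrN; apply: eq_bigr => j _.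
by rewrite /dx derive_opp// scalerN.
Qed.

Lemma Dt_scale (W : normedModType R) u f (w : W) p : differentiable f p ->
  Dt u (fun q => f q *: w) p = Dt u f p *: w.
Proof.
move=> df; rewrite /Dt /dt derive_scale// scalerDl; congr (_ + _).
rewrite /advect scaler_suml; apply: eq_bigr => j _.
by rewrite /dx derive_scale// scalerA.
Qed.

(** The commutator of [dx i] and [Dt u] comes from differentiating the advecting velocity; symmetry
    of second derivatives handles the rest. *)
Lemma dx_Dt (V : set (space_time R)) u f i p : open V -> V p ->
  Ck_on 1 V u -> Ck_on 2 V f ->
  dx i (Dt u f) p = Dt u (dx i f) p + \sum_(j < 3) dx i (fun q => u q 0 j) p * dx j f p.
Proof.
move=> oV Vp uC fC.
have du j : differentiable (fun q => u q 0 j) p.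
  exact: (Ck_on_diff (Ck_on_coord j oV uC)).
have ddx j : differentiable (dx j f) p.
  exact: (Ck_on_diff (Ck_on_derive _ fC)).
have dudx j : differentiable (fun q => u q 0 j * dx j f q) p.
  exact: differentiableM.
have sym v w : 'D_w ('D_v f) p = 'D_v ('D_w f) p.
  exact: (@derive_symmetric _ _ f p v w V oV Vp fC).
have advE : advect u f = \sum_(j < 3) (fun q => u q 0 j * dx j f q).
  by apply/funext => q; rewrite fct_sumE.
have dadv : differentiable (advect u f) p by rewrite advE; exact: differentiable_sum.
have E1 : 'D_(0, delta_mx 0 i) (dt f) p = dt (dx i f) p.
  exact: (sym (1, 0) (0, delta_mx 0 i)).
have E2 : 'D_(0, delta_mx 0 i) (advect u f) p = advect u (dx i f) p +
    \sum_(j < 3) dx i (fun q => u q 0 j) p * dx j f p.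
  rewrite advE derive_sum; last by move=> j; exact/diff_derivable.
  rewrite /advect -big_split /=; apply: eq_bigr => j _.
  rewrite (derive_mul _ (du j) (ddx j)).
  have -> : 'D_(0, delta_mx 0 i) (dx j f) p = dx j (dx i f) p.
    exact: (sym (0, delta_mx 0 j) (0, delta_mx 0 i)).
  by congr (_ + _); rewrite mulrC.
rewrite -[LHS]/('D_(0, delta_mx 0 i) (fun q => dt f q + advect u f q) p).
rewrite (derive_add _ (Ck_on_diff (Ck_on_derive ((1, 0) : space_time R) fC) Vp) dadv).
by rewrite E1 E2 addrA.
Qed.

End variations.

(** * The first variation for the three families of test variations *)

Section equations_of_motion.
Context {R : realType}.
Implicit Types (p q : space_time R) (f phi : space_time R -> R).
Variables (V : set (space_time R)) (B : flow R) (L : 'rV[R]_nvar -> R).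
Hypotheses (oV : open V)
  (rhoC : forall k, Ck_on k V (density B)) (sC : forall k, Ck_on k V (entropy B))
  (s1C : forall k, Ck_on k V (entropy1 B)) (s2C : forall k, Ck_on k V (entropy2 B))
  (aiC : forall k, Ck_on k V (area B)) (yC : forall k, Ck_on k V (massfrac B))
  (alphaC : forall k, Ck_on k V (volfrac B)) (uC : forall k, Ck_on k V (velocity B))
  (physV : forall p, V p -> physical_vars (state B p))
  (LC : forall k, Ck_on k physical_vars L).

Local Notation u := (velocity B).
Local Notation st := (state B).
Local Notation dL b := (fun p => partial b L (st p)).

Lemma Ck_dx k j f : Ck_on k.+1 V f -> Ck_on k V (dx j f).
Proof. by move=> [_]; exact. Qed.

Lemma Ck_dt k f : Ck_on k.+1 V f -> Ck_on k V (dt f).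
Proof. by move=> [_]; exact. Qed.

Lemma Ck_u k j : Ck_on k V (fun p => u p 0 j).
Proof. exact: Ck_on_coord. Qed.

Lemma Ck_Dt k f : Ck_on k.+1 V f -> Ck_on k V (Dt u f).
Proof.
move=> fC; apply: Ck_onD => //; first exact: Ck_dt.
by apply: Ck_on_sum => // j; apply: Ck_onM => //; [exact: Ck_u | exact: Ck_dx].
Qed.

Lemma Ck_state k : Ck_on k V st.
Proof.
apply: Ck_on_row => //; apply: nvarP.
- by rewrite (_ : (fun _ => _) = density B)//; apply/funext => q; rewrite mk_varsE.
- by rewrite (_ : (fun _ => _) = entropy B)//; apply/funext => q; rewrite mk_varsE.
- by rewrite (_ : (fun _ => _) = entropy1 B)//; apply/funext => q; rewrite mk_varsE.
- by rewrite (_ : (fun _ => _) = entropy2 B)//; apply/funext => q; rewrite mk_varsE.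
- by rewrite (_ : (fun _ => _) = area B)//; apply/funext => q; rewrite mk_varsE.
- by rewrite (_ : (fun _ => _) = massfrac B)//; apply/funext => q; rewrite mk_varsE.
- by rewrite (_ : (fun _ => _) = volfrac B)//; apply/funext => q; rewrite mk_varsE.
- rewrite (_ : (fun _ => _) = Dt u (volfrac B)); first exact: Ck_Dt.
  by apply/funext => q; rewrite mk_varsE.
- rewrite (_ : (fun _ => _) = Dt u (area B)); first exact: Ck_Dt.
  by apply/funext => q; rewrite mk_varsE.
- move=> j; rewrite (_ : (fun _ => _) = (fun q => u q 0 j)); first exact: Ck_u.
  by apply/funext => q; rewrite mk_varsE.
Qed.

Lemma Ck_L k : Ck_on k V (fun p => L (st p)).
Proof. by apply: (@Ck_on_comp_row R _ k _ V physical_vars st L) => //; exact: Ck_state. Qed.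

Lemma Ck_dL k b : Ck_on k V (dL b).
Proof.
apply: (@Ck_on_comp_row R _ k _ V physical_vars st (partial b L)) => //.
  exact: Ck_state.
exact: Ck_on_derive (LC k.+1).
Qed.

Lemma derive_L v p : V p -> 'D_v (fun q => L (st q)) p =
  partial i_rho L (st p) * 'D_v (density B) p +
  partial i_s L (st p) * 'D_v (entropy B) p +
  partial i_s1 L (st p) * 'D_v (entropy1 B) p +
  partial i_s2 L (st p) * 'D_v (entropy2 B) p +
  partial i_ai L (st p) * 'D_v (area B) p +
  partial i_y L (st p) * 'D_v (massfrac B) p +
  partial i_alpha L (st p) * 'D_v (volfrac B) p +
  partial i_Dalpha L (st p) * 'D_v (Dt u (volfrac B)) p +
  partial i_Dai L (st p) * 'D_v (Dt u (area B)) p +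
  \sum_(j < 3) partial (i_u j) L (st p) * 'D_v (fun q => u q 0 j) p.
Proof.
move=> Vp; rewrite (derive_comp_row (f := st) v (Ck_on_diff (Ck_state 1) Vp)
  (Ck_on_diff (LC 1) (physV Vp))) sum_nvar.
have E b f : (forall q, st q 0 b = f q) -> 'D_v (fun q => st q 0 b) p = 'D_v f p.
  by move=> bf; congr ('D_v _ p); exact/funext.
have mE q := mk_varsE (density B q) (entropy B q) (entropy1 B q) (entropy2 B q)
  (area B q) (massfrac B q) (volfrac B q) (Dt u (volfrac B) q) (Dt u (area B) q) (u q).
rewrite (E i_rho (density B)) => [|q]; last by rewrite mE.
rewrite (E i_s (entropy B)) => [|q]; last by rewrite mE.
rewrite (E i_s1 (entropy1 B)) => [|q]; last by rewrite mE.
rewrite (E i_s2 (entropy2 B)) => [|q]; last by rewrite mE.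
rewrite (E i_ai (area B)) => [|q]; last by rewrite mE.
rewrite (E i_y (massfrac B)) => [|q]; last by rewrite mE.
rewrite (E i_alpha (volfrac B)) => [|q]; last by rewrite mE.
rewrite (E i_Dalpha (Dt u (volfrac B))) => [|q]; last by rewrite mE.
rewrite (E i_Dai (Dt u (area B))) => [|q]; last by rewrite mE.
congr (_ + _); apply: eq_bigr => j _.
by rewrite (E (i_u j) (fun q => u q 0 j)) => [//|q]; rewrite mE.
Qed.

Lemma variation_volfrac phi p :
  \sum_(b < nvar) partial b L (st p) * delta_state B (fun=> 0) phi (fun=> 0) p 0 b =
  partial i_alpha L (st p) * phi p + partial i_Dalpha L (st p) * Dt u phi p.
Proof.
(* The partial derivatives are abstracted, so that the rewriting below evaluates the variations
   only. *)
have [D DE] : exists D, forall b, D b = partial b L (st p).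
  by exists (fun b => partial b L (st p)).
under eq_bigr => b _ do rewrite -DE.
rewrite -!DE {DE}.
have du : delta_u B (fun=> 0) p = 0 by rewrite /delta_u Dt0 advect0// subrr.
rewrite sum_nvar /delta_state !mk_varsE du /delta_transported !advect0// /delta_rho.
(* The zero field is written as a multiple of a basis vector so that [div_delta] applies. *)
rewrite [X in div X]( _ : _ = fun q => 0 *: delta_mx 0 0); last first.
  by apply/funext => q; rewrite scaler0 scale0r.
rewrite div_delta /dx derive_cst /delta_Dt !(advect0 _ du) !addr0.
rewrite -[dt _ p + _]/(Dt u phi p) -[dt (fun=> 0) p + _]/(Dt u (fun=> 0) p) Dt0.
rewrite big1; last by move=> j _; rewrite mk_varsE mxE mulr0.
by move: (phi p) (Dt u phi p) => a b; ring.
Qed.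

Lemma variation_area phi p :
  \sum_(b < nvar) partial b L (st p) * delta_state B (fun=> 0) (fun=> 0) phi p 0 b =
  partial i_ai L (st p) * phi p + partial i_Dai L (st p) * Dt u phi p.
Proof.
have [D DE] : exists D, forall b, D b = partial b L (st p).
  by exists (fun b => partial b L (st p)).
under eq_bigr => b _ do rewrite -DE.
rewrite -!DE {DE}.
have du : delta_u B (fun=> 0) p = 0 by rewrite /delta_u Dt0 advect0// subrr.
rewrite sum_nvar /delta_state !mk_varsE du /delta_transported !advect0// /delta_rho.
rewrite [X in div X]( _ : _ = fun q => 0 *: delta_mx 0 0); last first.
  by apply/funext => q; rewrite scaler0 scale0r.
rewrite div_delta /dx derive_cst /delta_Dt !(advect0 _ du) !addr0.
rewrite -[dt phi p + _]/(Dt u phi p) -[dt (fun=> 0) p + _]/(Dt u (fun=> 0) p) Dt0.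
rewrite big1; last by move=> j _; rewrite mk_varsE mxE mulr0.
by move: (phi p) (Dt u phi p) => a b; ring.
Qed.

(* Displacing along [e_i] and transporting [alpha] and [a_i] passively makes every
   variable vary by minus its derivative, up to terms in the derivatives of [phi]. *)
Lemma variation_displacement phi i p : V p -> (forall k, Ck_on k V phi) ->
  \sum_(b < nvar) partial b L (st p) *
    delta_state B (fun q => phi q *: delta_mx 0 i)
      (fun q => - (phi q * dx i (volfrac B) q))
      (fun q => - (phi q * dx i (area B) q)) p 0 b =
  - (phi p * dx i (fun q => L (st q)) p)
  - density B p * partial i_rho L (st p) * dx i phi p
  + partial (i_u i) L (st p) * Dt u phi p.
Proof.
move=> Vp phiC.
have d f : (forall k, Ck_on k V f) -> differentiable f p.
  by move=> fC; exact: (Ck_on_diff (fC 1)).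
have dphi := d _ phiC.
have du := Ck_on_diff (uC 1) Vp.
set xi := fun q => phi q *: delta_mx 0 i.
have xip : xi p = phi p *: delta_mx 0 i by [].
have drho : delta_rho B xi p = - (density B p * dx i phi p + phi p * dx i (density B) p).
  rewrite /delta_rho (_ : (fun q => _) = (fun q => (density B q * phi q) *: delta_mx 0 i)).
    by rewrite div_delta /dx derive_mul//; exact: d.
  by apply/funext => q; rewrite scalerA.
have dtr b : delta_transported b xi p = - (phi p * dx i b p).
  by rewrite /delta_transported (advect_delta _ xip).
have duE j : delta_u B xi p 0 j =
    Dt u phi p * (j == i)%:R - phi p * dx i (fun q => u q 0 j) p.
  rewrite /delta_u Dt_scale// (advect_delta _ xip) !mxE eqxx /=.
  by rewrite /dx derive_coord.
(* The term [Dt u phi * dx i f] produced by the product rule cancels against the [e_i] part of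
   [delta_u]; the remaining part of [delta_u] supplies the commutator in [dx_Dt]. *)
have dDt f : (forall k, Ck_on k V f) ->
    delta_Dt B f xi (fun q => - (phi q * dx i f q)) p = - (phi p * dx i (Dt u f) p).
  move=> fC; have ddx : differentiable (dx i f) p by apply: d => k; exact: Ck_dx.
  rewrite /delta_Dt -[dt _ p + _]/(Dt u _ p) Dt_opp; last exact: differentiableM.
  rewrite Dt_mul// (dx_Dt i oV Vp (uC 1) (fC 2)) /advect.
  under eq_bigr => j _ do rewrite duE /GRing.scale /= mulrBl.
  rewrite sumrB (bigD1 i)//= eqxx mulr1 big1 ?addr0; last first.
    by move=> j /negbTE ->; rewrite mulr0 mul0r.
  under [X in _ - X]eq_bigr => j _ do rewrite -mulrA.
  by rewrite -mulr_sumr; ring.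
rewrite sum_nvar /delta_state !mk_varsE drho !dtr !dDt//.
under eq_bigr => j _ do rewrite mk_varsE duE mulrBr.
rewrite sumrB [X in _ + (X - _)](bigD1 i)//= eqxx mulr1 big1 ?addr0; last first.
  by move=> j /negbTE ->; rewrite !mulr0.
under [X in _ - X]eq_bigr => j _ do rewrite mulrCA.
rewrite -mulr_sumr.
have dLE : dx i (fun q => L (st q)) p =
    partial i_rho L (st p) * dx i (density B) p +
    partial i_s L (st p) * dx i (entropy B) p +
    partial i_s1 L (st p) * dx i (entropy1 B) p +
    partial i_s2 L (st p) * dx i (entropy2 B) p +
    partial i_ai L (st p) * dx i (area B) p +
    partial i_y L (st p) * dx i (massfrac B) p +
    partial i_alpha L (st p) * dx i (volfrac B) p +
    partial i_Dalpha L (st p) * dx i (Dt u (volfrac B)) p +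
    partial i_Dai L (st p) * dx i (Dt u (area B)) p +
    \sum_(j < 3) partial (i_u j) L (st p) * dx i (fun q => u q 0 j) p.
  exact: derive_L.
rewrite dLE {dLE}.
move: (\sum_(j < 3) _) (partial (i_u i) L _) (Dt u phi p) => S K Dphi.
move: (dx i (Dt u (volfrac B)) p) (dx i (Dt u (area B)) p) => DDalpha DDai.
move: (dx i (density B) p) (dx i (entropy B) p) (dx i (entropy1 B) p)
  (dx i (entropy2 B) p) (dx i (area B) p) (dx i (massfrac B) p)
  (dx i (volfrac B) p) (dx i phi p) => Drho Ds Ds1 Ds2 Dai Dy Dalpha dxphi.
move: (partial i_rho L _) (partial i_s L _) (partial i_s1 L _) (partial i_s2 L _)
  (partial i_ai L _) (partial i_y L _) (partial i_alpha L _)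
  (partial i_Dalpha L _) (partial i_Dai L _) => Lrho Ls Ls1 Ls2 Lai Ly Lal LDal LDai.
move: (density B p) (phi p) => rho F.
ring.
Qed.

End equations_of_motion.

(** * From stationarity to the differential equations *)

Section stationarity.
Context {R : realType}.
Implicit Types (p q : space_time R) (f phi : space_time R -> R).

Lemma eq_integral_over (Omega : set (space_time R)) f g :
  (forall p, Omega p -> f p = g p) -> integral_over Omega f = integral_over Omega g.
Proof.
move=> fg; rewrite !integral_overE; apply: eq_integral => q qO.
have Oq : Omega (of_coords q) := set_mem qO.
by rewrite (fg _ Oq).
Qed.

(** Expands the divergence in [conservation_form] into terms in [phi] and its first derivatives, the
    shape in which the variations were computed. *)
Lemma flux_mul (a0 : space_time R -> R) (a : 'I_3 -> space_time R -> R) phi p :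
  differentiable a0 p -> (forall j, differentiable (a j) p) ->
  differentiable phi p ->
  dt (fun q => a0 q * phi q) p + \sum_(j < 3) dx j (fun q => a j q * phi q) p =
  phi p * (dt a0 p + \sum_(j < 3) dx j (a j) p) +
  (a0 p * dt phi p + \sum_(j < 3) a j p * dx j phi p).
Proof.
move=> d0 da dphi; rewrite /dt /dx (derive_mul _ d0 dphi).
under eq_bigr => j _ do rewrite (derive_mul _ (da j) dphi).
rewrite big_split /= -mulr_sumr mulrDr.
move: (\sum_(_ < _) _) (\sum_(_ < _) _) ('D__ a0 p) ('D__ phi p) => *; ring.
Qed.

Variables (Omega V : set (space_time R)) (B : flow R) (L : 'rV[R]_nvar -> R).
Hypotheses (rO : regular_domain Omega) (oV : open V) (OV : Omega `<=` V)
  (rhoC : forall k, Ck_on k V (density B)) (sC : forall k, Ck_on k V (entropy B))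
  (s1C : forall k, Ck_on k V (entropy1 B)) (s2C : forall k, Ck_on k V (entropy2 B))
  (aiC : forall k, Ck_on k V (area B)) (yC : forall k, Ck_on k V (massfrac B))
  (alphaC : forall k, Ck_on k V (volfrac B)) (uC : forall k, Ck_on k V (velocity B))
  (physV : forall p, V p -> physical_vars (state B p))
  (LC : forall k, Ck_on k physical_vars L)
  (statL : stationary Omega L B).

Local Notation u := (velocity B).
Local Notation st := (state B).
Local Notation dL b := (fun p => partial b L (st p)).

Let dLC b k : Ck_on k V (dL b).
Proof. exact: Ck_dL. Qed.

Let ujC k j : Ck_on k V (fun q => u q 0 j).
Proof. exact: Ck_on_coord. Qed.

Let diffV f p : (forall k, Ck_on k V f) -> V p -> differentiable f p.
Proof. by move=> /(_ 1); exact: Ck_on_diff. Qed.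

(** Covers fields such as [- phi dx i alpha], which are smooth on [V] only and inherit the boundary
    condition pointwise from [phi]. *)
Lemma test_function_vanishing (W : normedModType R) (phi : space_time R -> R)
    (h : space_time R -> W) :
  test_function Omega phi -> (forall k, Ck_on k V h) ->
  (forall q, phi q = 0 -> h q = 0) -> test_function Omega h.
Proof.
move=> [_ phi0] hC h0; split; first by exists V.
by move=> q /phi0/h0.
Qed.

(** Treats [alpha] and [a_i] at once: [c] indexes the varied quantity, [b] its material derivative,
    and [dalpha], [dai] are the identity and zero in one order or the other. The integrand is the
    divergence of [phi] times the flux [L_b (1, u)], minus [phi] times the equation. *)
Lemma transport_equation (b c : 'I_nvar) (dalpha dai : (space_time R -> R) -> space_time R -> R) :
  (forall phi, (forall k, Ck_on k setT phi) -> test_function Omega phi ->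
    test_function Omega (dalpha phi) /\ test_function Omega (dai phi)) ->
  (forall phi p, \sum_(d < nvar) partial d L (st p) *
     delta_state B (fun=> 0) (dalpha phi) (dai phi) p 0 d =
     partial c L (st p) * phi p + partial b L (st p) * Dt u phi p) ->
  forall p, Omega p ->
  dt (dL b) p + div (fun q => dL b q *: u q) p - partial c L (st p) = 0.
Proof.
move=> test var p Op.
have divE q : div (fun q => dL b q *: u q) q =
    \sum_(j < 3) dx j (fun q => dL b q * u q 0 j) q.
  by apply: eq_bigr => j _; congr (dx j _ _); apply/funext => z; rewrite mxE.
rewrite divE.
have MujC j k : Ck_on k V (fun q => dL b q * u q 0 j) by exact: Ck_onM.
apply: (@conservation_form R Omega V
  (fun p => dt (dL b) p + \sum_(j < 3) dx j (fun q => dL b q * u q 0 j) p - dL c p)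
  (dL b) (fun j q => dL b q * u q 0 j)) => //.
- apply: Ck_onB => //; apply: Ck_onD => //; first exact: Ck_dt.
  by apply: Ck_on_sum => // j; exact: Ck_dx.
move=> phi phiC phiT; have [T1 T2] := test phi phiC phiT.
have T0 : test_function Omega (fun=> 0 : 'rV[R]_3).
  by apply: (test_function_vanishing phiT) => // k; exact: Ck_on_cst.
(* The 0 on the right is traded for the first variation, so the integrands are compared pointwise on
   [Omega]. *)
rewrite -[RHS](statL T0 T1 T2); apply: eq_integral_over => q /OV Vq.
have dphi : differentiable phi q by exact: (Ck_on_diff (phiC 1)).
rewrite var (@flux_mul (dL b) (fun j q => dL b q * u q 0 j))//; last 2 first.
- by apply: diffV.
- by move=> j; apply: diffV.
rewrite /Dt /advect.
under [\sum_(j < 3) dL b q * _ * _]eq_bigr => j _ do rewrite -mulrA.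
rewrite -mulr_sumr.
move: (\sum_(_ < 3) (_ *: _)) => S.
move: (dt (dL b) q) (\sum_(_ < 3) _) (partial _ _ _) (partial _ _ _) (phi q) (dt phi q) => *.
ring.
Qed.

Lemma momentum_equation i p : Omega p ->
  dt (dL (i_u i)) p + \sum_(j < 3) dx j (fun q => dL (i_u i) q * u q 0 j) p -
  dx i (fun q => density B q * dL i_rho q - L (st q)) p = 0.
Proof.
move=> Op.
pose K := dL (i_u i); pose rhoL q := density B q * dL i_rho q.
(* The flux carries only the [rho L_rho] part of [L^{*,rho}]; the part [- L] enters through the term
   [- phi dx i L], where [phi] is not differentiated. *)
pose A j q := K q * u q 0 j - (j == i)%:R * rhoL q.
have rhoLC k : Ck_on k V rhoL by exact: Ck_onM.
have KC k : Ck_on k V K by exact: dLC.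
have LstC k : Ck_on k V (fun q => L (st q)) by exact: Ck_L.
have KujC j k : Ck_on k V (fun q => K q * u q 0 j) by exact: Ck_onM.
have drhoLC j k : Ck_on k V (fun q => (j == i)%:R * rhoL q).
  by apply: Ck_onM => //; exact: Ck_on_cst.
have AC j k : Ck_on k V (A j) by exact: Ck_onB.
apply: (@conservation_form R Omega V
  (fun p => dt K p + \sum_(j < 3) dx j (fun q => K q * u q 0 j) p -
     dx i (fun q => rhoL q - L (st q)) p) K A) => //.
- apply: Ck_onB => //; last by apply: Ck_dx; exact: Ck_onB.
  apply: Ck_onD => //; first exact: Ck_dt.
  by apply: Ck_on_sum => // j; exact: Ck_dx.
move=> phi phiC phiT.
have phiVC k : Ck_on k V phi by exact: Ck_on_sub (phiC k).
have T f : (forall k, Ck_on k V f) -> test_function Omega (fun q => - (phi q * dx i f q)).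
  move=> fC; apply: (test_function_vanishing phiT) => [k|q ->]; last by rewrite mul0r oppr0.
  by apply: Ck_onN => //; apply: Ck_onM => //; exact: Ck_dx.
have Txi : test_function Omega (fun q => phi q *: (delta_mx 0 i : 'rV[R]_3)).
  by apply: (test_function_vanishing phiT) => [k|q ->]; [exact: Ck_onZl | rewrite scale0r].
rewrite -[RHS](statL Txi (T _ alphaC) (T _ aiC)).
apply: eq_integral_over => q /OV Vq.
rewrite (variation_displacement (V := V))//.
have dphi : differentiable phi q by exact: diffV.
rewrite flux_mul//; last 2 first.
- exact: diffV.
- by move=> j; exact: diffV.
have -> : \sum_(j < 3) dx j (A j) q =
    \sum_(j < 3) dx j (fun q => K q * u q 0 j) q - dx i rhoL q.
  under eq_bigr => j _ do rewrite /dx (derive_sub _ (diffV (KujC j) Vq) (diffV (drhoLC j) Vq)).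
  rewrite sumrB; congr (_ - _); rewrite (bigD1 i)//= big1 ?addr0 => [|j /negbTE ji].
    by congr (dx i _ q); apply/funext => z; rewrite eqxx mul1r.
  rewrite (_ : (fun q => _) = (fun=> 0)) ?derive_cst//.
  by apply/funext => z; rewrite ji mul0r.
have -> : \sum_(j < 3) A j q * dx j phi q =
    K q * advect u phi q - rhoL q * dx i phi q.
  under eq_bigr => j _ do rewrite /A mulrBl -!mulrA.
  rewrite sumrB -mulr_sumr; congr (_ - _).
  rewrite (bigD1 i)//= eqxx mul1r big1 ?addr0; first exact: mulrA.
  by move=> j /negbTE ->; rewrite mul0r.
have -> : dx i (fun z => rhoL z - L (st z)) q = dx i rhoL q - dx i (fun z => L (st z)) q.
  exact: (derive_sub _ (diffV rhoLC Vq) (diffV LstC Vq)).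
have -> : Dt u phi q = dt phi q + advect u phi q by [].
rewrite -[partial (i_u i) L (st q)]/(K q) -[density B q * _]/(rhoL q).
move: (K q) (rhoL q) (dt K q) (\sum_(_ < 3) _) (dx i rhoL q)
  (dx i (fun z => L (st z)) q) (dx i phi q) (dt phi q) (advect u phi q) (phi q).
by move=> *; ring.
Qed.

End stationarity.

Theorem mainTheorem4 (R : realType) (t1 t2 : R) (ht : t1 < t2)
    (omega : R -> set 'rV[R]_3)
    (hOmega : regular_domain (space_time_domain t1 t2 omega))
    (m nu : R) (hm : 0 < m) (hnu : 0 < nu)
    (e1 e2 : R -> R -> R) (ei : R -> R)
    (he1 : smooth_on [set v : R * R | 0 < v.1] (fun v => e1 v.1 v.2))
    (he2 : smooth_on [set v : R * R | 0 < v.1] (fun v => e2 v.1 v.2))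
    (hei : smooth_on [set: R] ei)
    (B : flow R)
    (hB : smooth_flow (space_time_domain t1 t2 omega) B)
    (hphys : physical_flow (space_time_domain t1 t2 omega) B)
    (hcons : conservation_laws (space_time_domain t1 t2 omega) B)
    (hstat : stationary (space_time_domain t1 t2 omega) (lagrangian m nu e1 e2 ei) B) :
  let L := lagrangian m nu e1 e2 ei in
  let M := fun p => partial i_Dalpha L (state B p) in
  let P := fun p => partial i_Dai L (state B p) in
  let K := fun p => partial_u L (state B p) in
  let Lstar := fun p => legendre_rho L (state B p) in
  forall p : space_time R,
    space_time_domain t1 t2 omega p ->
    [/\ dt M p + div (fun q => M q *: velocity B q) p - partial i_alpha L (state B p) = 0,
        dt P p + div (fun q => P q *: velocity B q) p - partial i_ai L (state B p) = 0
      & dt K p + div_tensor K (velocity B) p - grad Lstar p = 0].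
Proof.
move=> L M P K Lstar p Op.
case: hB => -[U1 [oU1 OU1 C1]] [[U2 [oU2 OU2 C2]] [U3 [oU3 OU3 C3]] [U4 [oU4 OU4 C4]]]
  [[U5 [oU5 OU5 C5]] [U6 [oU6 OU6 C6]]] [U7 [oU7 OU7 C7]] [U8 [oU8 OU8 C8]].
set Omega := space_time_domain t1 t2 omega in hOmega hphys hstat Op OU1 OU2 OU3 OU4 OU5 OU6 OU7 OU8 *.
(* Each field comes with its own neighbourhood of [Omega]; [V0] is common to all of them. *)
pose V0 := U1 `&` U2 `&` U3 `&` U4 `&` U5 `&` U6 `&` U7 `&` U8.
have oV0 : open V0 by do ?apply: openI.
have OV0 : Omega `<=` V0.
  by move=> q Oq; do ?split; [exact: OU1 | exact: OU2 | exact: OU3 | exact: OU4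
    | exact: OU5 | exact: OU6 | exact: OU7 | exact: OU8].
have V01 : V0 `<=` U1 by move=> q [[[[[[[]]]]]]].
have V02 : V0 `<=` U2 by move=> q [[[[[[[]]]]]]].
have V03 : V0 `<=` U3 by move=> q [[[[[[[]]]]]]].
have V04 : V0 `<=` U4 by move=> q [[[[[[[]]]]]]].
have V05 : V0 `<=` U5 by move=> q [[[[[[[]]]]]]].
have V06 : V0 `<=` U6 by move=> q [[[[[[[]]]]]]].
have V07 : V0 `<=` U7 by move=> q [[[[[[[]]]]]]].
have V08 : V0 `<=` U8 by move=> q [].
(* [V0] is cut down by one strict inequality at a time: each set is open because the field is
   continuous on the previous one, and the last set [V] carries only physical states. *)
pose wherepos (W : set (space_time R)) (f : space_time R -> R) := [set q | W q /\ 0 < f q].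
have oneB W (f : space_time R -> R) : open W -> Ck_on 0 W f -> Ck_on 0 W (fun q => 1 - f q).
  by move=> oW fC; apply: Ck_onB => //; exact: Ck_on_cst.
pose V1 := wherepos V0 (density B).
have oV1 : open V1 by apply: open_setI_gt0 => //; exact: Ck_on_sub V01 (C1 0).
have V10 : V1 `<=` V0 by move=> q [].
pose V2 := wherepos V1 (area B).
have oV2 : open V2 by apply: open_setI_gt0 => //; exact: Ck_on_sub V10 (Ck_on_sub V05 (C5 0)).
have V20 : V2 `<=` V0 by move=> q [/V10].
pose V3 := wherepos V2 (massfrac B).
have oV3 : open V3 by apply: open_setI_gt0 => //; exact: Ck_on_sub V20 (Ck_on_sub V06 (C6 0)).
have V30 : V3 `<=` V0 by move=> q [/V20].
pose V4 := wherepos V3 (fun q => 1 - massfrac B q).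
have oV4 : open V4.
  by apply: open_setI_gt0 => //; apply: oneB => //; exact: Ck_on_sub V30 (Ck_on_sub V06 (C6 0)).
have V40 : V4 `<=` V0 by move=> q [/V30].
pose V5 := wherepos V4 (volfrac B).
have oV5 : open V5 by apply: open_setI_gt0 => //; exact: Ck_on_sub V40 (Ck_on_sub V07 (C7 0)).
have V50 : V5 `<=` V0 by move=> q [/V40].
pose V := wherepos V5 (fun q => 1 - volfrac B q).
have oV : open V.
  by apply: open_setI_gt0 => //; apply: oneB => //; exact: Ck_on_sub V50 (Ck_on_sub V07 (C7 0)).
have VV0 : V `<=` V0 by move=> q [/V50].
have OV : Omega `<=` V.
  move=> q Oq; have [rho0 ai0 /andP[y0 y1] /andP[a0 a1]] := hphys q Oq.
  rewrite -subr_gt0 in y1; rewrite -subr_gt0 in a1.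
  exact: (conj (conj (conj (conj (conj (conj (OV0 q Oq) rho0) ai0) y0) y1) a0) a1).
have physV q : V q -> physical_vars (state B q).
  by move=> [[[[[[_ ?] ?] ?] ?] ?] ?]; rewrite /physical_vars /state /= !mk_varsE.
have LC k : Ck_on k physical_vars L by exact: Ck_lagrangian.
have rhoC k : Ck_on k V (density B) by exact: Ck_on_sub VV0 (Ck_on_sub V01 (C1 k)).
have sC k : Ck_on k V (entropy B) by exact: Ck_on_sub VV0 (Ck_on_sub V02 (C2 k)).
have s1C k : Ck_on k V (entropy1 B) by exact: Ck_on_sub VV0 (Ck_on_sub V03 (C3 k)).
have s2C k : Ck_on k V (entropy2 B) by exact: Ck_on_sub VV0 (Ck_on_sub V04 (C4 k)).
have aiC k : Ck_on k V (area B) by exact: Ck_on_sub VV0 (Ck_on_sub V05 (C5 k)).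
have yC k : Ck_on k V (massfrac B) by exact: Ck_on_sub VV0 (Ck_on_sub V06 (C6 k)).
have alphaC k : Ck_on k V (volfrac B) by exact: Ck_on_sub VV0 (Ck_on_sub V07 (C7 k)).
have uC k : Ck_on k V (velocity B) by exact: Ck_on_sub VV0 (Ck_on_sub V08 (C8 k)).
have T0 (phi : space_time R -> R) : test_function Omega phi -> test_function Omega (fun=> 0 : R).
  move=> phiT; apply: (test_function_vanishing oV OV phiT) => // k; exact: Ck_on_cst.
split.
- apply: (transport_equation hOmega oV OV rhoC sC s1C s2C aiC yC alphaC uC physV LC hstat
    (dalpha := id) (dai := fun _ => fun=> 0)) => //.
  + by move=> phi _ phiT; split=> //; exact: T0 phiT.
  + by move=> phi q; exact: variation_volfrac.
- apply: (transport_equation hOmega oV OV rhoC sC s1C s2C aiC yC alphaC uC physV LC hstat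
    (dalpha := fun _ => fun=> 0) (dai := id)) => //.
  + by move=> phi _ phiT; split=> //; exact: T0 phiT.
  + by move=> phi q; exact: variation_area.
apply/rowP => i.
have mom := momentum_equation hOmega oV OV rhoC sC s1C s2C aiC yC alphaC uC physV LC hstat i Op.
(* Differentiability of the vector-valued [K] allows [dt K] to be read off coordinate by
   coordinate. *)
have KC : Ck_on 1 V K.
  apply: Ck_on_row => // j.
  rewrite (_ : (fun q => _) = (fun q => partial (i_u j) L (state B q))); first exact: Ck_dL.
  by apply/funext => q; rewrite mxE.
have KE : (fun q => K q 0 i) = (fun q => partial (i_u i) L (state B q)).
  by apply/funext => q; rewrite mxE.
have LE : Lstar = (fun q => density B q * partial i_rho L (state B q) - L (state B q)).
  by apply/funext => q; rewrite /Lstar /legendre_rho /state !mk_varsE.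
have dtK : (dt K p) 0 i = dt (fun q => partial (i_u i) L (state B q)) p.
  by rewrite /dt (derive_coord _ _ (Ck_on_diff KC (OV _ Op))) KE.
have divK : div_tensor K (velocity B) p 0 i =
    \sum_(j < 3) dx j (fun q => partial (i_u i) L (state B q) * velocity B q 0 j) p.
  rewrite mxE; apply: eq_bigr => j _; congr (dx j _ p).
  by apply/funext => q; rewrite -[K q 0 i]/((fun q => K q 0 i) q) KE.
have gradL : grad Lstar p 0 i =
    dx i (fun q => density B q * partial i_rho L (state B q) - L (state B q)) p.
  by rewrite mxE LE.
have -> : (dt K p + div_tensor K (velocity B) p - grad Lstar p) 0 i =
    dt K p 0 i + div_tensor K (velocity B) p 0 i - grad Lstar p 0 i.
  by rewrite [LHS]mxE [X in X + _ = _]mxE [X in _ + X = _]mxE.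
by rewrite dtK divK gradL mom mxE.
Qed.
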